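(* Fix $p\in(1,\infty)$. (I) Let $\delta\in[0,1]$ and let $F\colon[\delta,1]\to[0,1]$ be concave, non-decreasing and satisfying $F(u)\le u$ for each $u\in[\delta,1]$. Then: (a) there exists a (non-doubling) metric measure space $\mathfrak{Y}$ such that, for all $q,r\in[1,\infty]$, $\mathbf{c}(p,q,r,\mathfrak{Y})<\infty$ if and only if $\frac1q\ge\delta$ and $\frac1r\le F\big(\frac1q\big)$; (b) there exists a (non-doubling) metric measure space $\mathfrak{Z}$ such that, for all $q,r\in[1,\infty]$, $\mathbf{c}(p,q,r,\mathfrak{Z})<\infty$ if and only if $\frac1q\ge\delta$ and $\frac1r< F\big(\frac1q\big)$. (II) Let $\delta\in[0,1)$ and let $F\colon(\delta,1]\to[0,1]$ be concave, non-decreasing and satisfying $F(u)\le u$ for each $u\in(\delta,1]$. Then: (a) there exists a (non-doubling) metric measure space $\mathfrak{Y}$ such that, for all $q,r\in[1,\infty]$, $\mathbf{c}(p,q,r,\mathfrak{Y})<\infty$ if and only if $\frac1q>\delta$ and $\frac1r\le F\big(\frac1q\big)$; (b) there exists a (non-doubling) metric measure space $\mathfrak{Z}$ such that, for all $q,r\in[1,\infty]$, $\mathbf{c}(p,q,r,\mathfrak{Z})<\infty$ if and only if $\frac1q>\delta$ and $\frac1r< F\big(\frac1q\big)$.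
   Context: A metric measure space is a triple $\mathfrak{X}=(X,\rho,\mu)$ where $X$ is a set, $\rho$ a metric on $X$, and $\mu$ a Borel measure on $X$. $B(x,s)$ denotes the open ball with center $x$ and radius $s>0$. The space is doubling if there is a constant $C$ with $\mu(B(x,2s))\le C\mu(B(x,s))$ for all $x\in X$, $s>0$, and non-doubling otherwise. The centered Hardy--Littlewood maximal operator is $$\mathcal{M}_{\mathfrak{X}} f(x) := \sup_{s>0} \frac{1}{\mu(B(x,s))}\int_{B(x,s)} |f|\,d\mu, \qquad x\in X,$$ for Borel $f\colon X\to\mathbb{C}$, with the convention that $\frac{1}{\mu(B)}\int_B |f|\,d\mu = 0$ whenever $\mu(B)\in\{0,\infty\}$. For a Borel function $f$ let $d_f(t) := \mu(\{x\in X: |f(x)|\ge t\})$. For $p\in[1,\infty)$ and $q\in[1,\infty]$, the Lorentz space $L^{p,q}(\mathfrak{X})$ consists of those $f$ for which the quasi-norm $\|f\|_{p,q}$ is finite, where $\|f\|_{p,q} := p^{1/q}\big(\int_0^\infty (t\,d_f(t)^{1/p})^q \frac{dt}{t}\big)^{1/q}$ if $q<\infty$, and $\|f\|_{p,\infty} := \sup_{t>0} t\,d_f(t)^{1/p}$. For $p\in(1,\infty)$ and $q,r\in[1,\infty]$, $\mathbf{c}(p,q,r,\mathfrak{X})$ denotes the smallest constant $C$ such that $\|\mathcal{M}_{\mathfrak{X}} f\|_{p,r}\le C\|f\|_{p,q}$ for all $f\in L^{p,q}(\mathfrak{X})$, with $\mathbf{c}(p,q,r,\mathfrak{X})=\infty$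 if no such constant exists. Conventions: $1/\infty=0$, $1/0=\infty$; for $\delta=1$, $[\delta,1]=\{1\}$. *)

(* Defs.v *)
From HB Require Import structures.
From mathcomp Require Import all_boot all_order all_algebra.
From mathcomp Require Import all_classical all_reals all_analysis.
From mathcomp Require Import complex.

Set Implicit Arguments.
Unset Strict Implicit.
Unset Printing Implicit Defensive.

Import Order.TTheory GRing.Theory Num.Theory.
Import numFieldTopology.Exports numFieldNormedType.Exports.

Local Open Scope classical_set_scope.
Local Open Scope ring_scope.

#[short(type="pmetricType")]
HB.structure Definition PointedMetric (K : numDomainType) :=
  { M of Metric K M & isPointed M }.

(* The point comes from [g_sigma_algebraType], which is only a measurable type
   over a pointed carrier; it amounts to the carrier being nonempty. *)
Notation borel X := (g_sigma_algebraType (@open X)).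

Record metric_measure_space (R : realType) := MetricMeasureSpace {
  mms_carrier :> pmetricType R ;
  mms_measure : {measure set (borel mms_carrier) -> \bar R} }.

Definition doubling (R : realType) (X : metric_measure_space R) :=
  exists C : R, forall (x : X) (s : R), 0 < s ->
    (mms_measure X (ball x (2 * s)) <= C%:E * mms_measure X (ball x s))%E.

Section maximal_operator.
Context (R : realType) (X : metric_measure_space R).
Let mu := mms_measure X.
Local Open Scope ereal_scope.

Definition borel_fun (f : X -> R[i]) :=
  measurable_fun [set: borel X] (f : borel X -> borel (R[i])^o).

Definition modulus (f : X -> R[i]) (x : X) : \bar R := (Normc.normc (f x))%:E.

Definition average (f : X -> R[i]) (B : set X) : \bar R :=
  if (mu B == 0) || (mu B == +oo) then 0
  else (mu B)^-1 * \int[mu]_(y in B) modulus f y.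

Definition maximal (f : X -> R[i]) (x : X) : \bar R :=
  ereal_sup [set average f (ball x s) | s in [set s : R | (0 < s)%R]].

End maximal_operator.

Section lorentz.
Context (R : realType) (X : metric_measure_space R).
Let mu := mms_measure X.
Local Open Scope ereal_scope.

(* Extended-real valued, since [maximal f] may take the value +oo. *)
Implicit Type g : X -> \bar R.

Definition dist_fun g (t : R) : \bar R := mu [set x : X | t%:E <= `|g x|].

(* Only exponents q in [1, +oo] are meant; q = -oo gets a dummy value. *)
Definition lorentz_norm (p : R) (q : \bar R) g : \bar R :=
  match q with
  | q'%:E =>
      (p `^ q'^-1)%:E *
      (\int[lebesgue_measure]_(t in `]0%R, +oo[)
         ((t%:E * dist_fun g t `^ p^-1) `^ q' * (t^-1)%:E)) `^ q'^-1
  | +oo => ereal_sup [set t%:E * dist_fun g t `^ p^-1 | t in `]0%R, +oo[]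
  | -oo => 0
  end.

Definition lorentz_space (p : R) (q : \bar R) : set (X -> R[i]) :=
  [set f | borel_fun f /\ lorentz_norm p q (modulus f) < +oo].

(* The infimum is attained when the set of admissible constants is nonempty,
   and it is +oo otherwise. *)
Definition best_const (p : R) (q r : \bar R) : \bar R :=
  ereal_inf [set C%:E | C in [set C : R | (0 <= C)%R /\
    forall f, lorentz_space p q f ->
      lorentz_norm p r (maximal f) <= C%:E * lorentz_norm p q (modulus f)]].

End lorentz.
Arguments best_const {R} X p q r : rename.

Definition concave_function (R : realType) (D : set R) (F : R -> R) :=
  @convex_function R R^o D (fun u => - F u).

Definition admissible (R : realType) (D : set R) (F : R -> R) :=
  [/\ concave_function D F,
      {in D &, {homo F : u v / u <= v}},
      {in D, forall u, 0 <= F u <= 1} &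
      {in D, forall u, F u <= u}].

(* [recip q] is 1/q for q in [1, +oo], with 1/+oo = 0. *)
Definition recip (R : realType) (q : \bar R) : R := fine (q^-1)%E.

(* Main.v *)
Require Import Defs.
From HB Require Import structures.
From mathcomp Require Import all_boot all_order all_algebra.
From mathcomp Require Import all_classical all_reals all_analysis.
From mathcomp Require Import measurable_realfun complex ring lra zify.

(** Let [X] be a graph with the distance [1] between neighbours and [2] between
    all other pairs of distinct points: a ball is a point, a neighbourhood or [X],
    and averages over balls of infinite measure vanish.  The vertices are grouped
    into tiers; tier [a] has [2 ^ e a] points of the same mass [m a].  Each block
    [i] consists of [N i] center tiers and [L i] leaf tiers.  A leaf is joined to
    one point of every center tier of its block, so that [M f] at a leaf is
    comparable to [|f|] plus the integral of [|f|] over these points divided by the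
    mass of the leaf, while all the centers of [X] are joined to each other, so that
    [M f = |f|] there and [X] is not doubling.

    The masses grow so fast that the measures of the nonempty sets of one tier
    are negligible with respect to those of the later tiers.  Then the norm of [f]
    in L^{p,q} is equivalent to the l^q norm of the numbers
    [(m a 2^b) ^ (1/p) f*_a(2^b)], where [f*_a] is the decreasing rearrangement of
    [f] on tier [a].  In these coordinates [M] is, on each pair of tiers, a
    convolution with a geometrically decaying kernel, and choosing
    [m = (2^e) ^ (1/(p-1))] for centers and [m = (2^e (N/K)^p) ^ (1/(p-1))] for
    leaves makes the norm of [M] from L^{p,q} to L^{p,r} on block [i] comparable to
    [K i * N i ^ (- 1/q) * L i ^ (1/r)].  So [M] is bounded if and only if this
    quantity is bounded in [i].  With [K], [N] and [L] powers of [2], each block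
    imposes an affine condition on [(1/q, 1/r)], and the regions of the theorem
    are cut out by two families of such conditions: one for the supporting lines
    of the graph of [F], one for the vertical side over [delta]. *)

Set Implicit Arguments.
Unset Strict Implicit.
Unset Printing Implicit Defensive.
Import Order.TTheory GRing.Theory Num.Theory.
Import numFieldTopology.Exports numFieldNormedType.Exports.
Local Open Scope classical_set_scope.
Local Open Scope ring_scope.

(** * The space of a layout *)

(* Tier [a] consists of the points [(a, k)] with [k < 2 ^ lexp a]; the other pairs
   are points of mass zero.  [center_of a c] means that the points of tier [a] are
   leaves joined to centers in tier [c]. *)
Record layout (R : realType) := Layout {
  lexp : nat -> nat;
  lmass : nat -> {posnum R};
  leaf : nat -> bool;
  center_of : nat -> nat -> bool }.

Definition carrier (R : realType) (T : layout R) : Type := (nat * nat)%type.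

Section carrier.
Context (R : realType) (T : layout R).
Local Notation e := (lexp T).
Local Notation X := (carrier T).

HB.instance Definition _ := Choice.copy X (nat * nat)%type.
HB.instance Definition _ := isPointed.Build X (0, 0)%N.

(** Reduction modulo the size of the center tier spreads the leaves evenly: sizes are powers of 2,
    so each center of an earlier tier receives equally many leaves once the exponents are
    nondecreasing. *)
Definition link (x y : X) : bool :=
  center_of T x.1 y.1 && (y.2 == x.2 %% 2 ^ e y.1)%N.

Definition gadjacent (x y : X) : bool :=
  [|| ~~ leaf T x.1 && ~~ leaf T y.1, link x y | link y x].

Definition gdist (x y : X) : R :=
  if x == y then 0 else if gadjacent x y then 1 else 2.

Let gdistxx x : gdist x x = 0.
Proof. by rewrite /gdist eqxx. Qed.

Let gdist_eq0 x y : gdist x y = 0 -> x = y.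
Proof.
rewrite /gdist; case: eqP => // _; case: ifP => _ /eqP; rewrite ?oner_eq0//.
by rewrite pnatr_eq0.
Qed.

Let gdistC x y : gdist x y = gdist y x.
Proof.
by rewrite /gdist eq_sym /gadjacent andbC [link x y || _]orbC.
Qed.

Let gdist_triangle y x z : gdist x z <= gdist x y + gdist y z.
Proof.
rewrite /gdist; have [<-|xy] := eqVneq x y; first by rewrite add0r.
have [<-|yz] := eqVneq y z; first by rewrite addr0 (negbTE xy).
by case: (x == z); case: (gadjacent x z); case: (gadjacent x y);
  case: (gadjacent y z); lra.
Qed.

HB.instance Definition _ := isMetric.Build R X
  gdistxx gdist_eq0 gdistC gdist_triangle.


Lemma ball_gdist (x : X) r : ball x r = [set y | gdist x y < r].
Proof. exact: (@ballEmdist R X). Qed.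

(** Distinct points are at distance at least 1, so open balls of radius 1 are singletons and every
    set is open. *)
Lemma measurable_carrier (A : set (borel X)) : measurable A.
Proof.
apply: sub_sigma_algebra; rewrite openE => x Ax /=.
apply/nbhs_ballP; exists 1 => //= y; rewrite ball_gdist /= /gdist.
by case: eqP => [<-//|_]; case: ifP; lra.
Qed.

Lemma measurable_fun_carrier d (U : measurableType d) (f : borel X -> U) D :
  measurable_fun D f.
Proof. by move=> _ Y _; exact: measurable_carrier. Qed.

Definition tier_measure (a : nat) : {measure set (borel X) -> \bar R} :=
  mscale (lmass T a)%:num%:nng
    (msum (fun k => \d_((a, k) : borel X)) (2 ^ e a)).

Definition carrier_measure : {measure set (borel X) -> \bar R} :=
  mseries tier_measure 0.

Definition layout_space := MetricMeasureSpace carrier_measure.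

(** The integral of [f] against [tier_measure a], as a real number. *)
Definition tier_sum (f : X -> R) a : R :=
  (lmass T a)%:num * \sum_(k < 2 ^ e a) f (a, k : nat).

Lemma carrier_measureE (A : set X) :
  mms_measure layout_space A = (\sum_(a <oo) (tier_sum \1_A a)%:E)%E.
Proof.
rewrite /= /carrier_measure /mseries; apply: eq_eseriesr => a _.
rewrite /tier_measure /mscale/= /msum/= /tier_sum EFinM -sumEFin.
by [].
Qed.

Lemma carrier_integralE (A : set X) (f : X -> R) :
  (forall x, 0 <= f x) ->
  (\int[mms_measure layout_space]_(x in A) (f x)%:E =
   \sum_(a <oo) (tier_sum (fun x => \1_A x * f x) a)%:E)%E.
Proof.
move=> f0.
have mA : measurable (A : set (borel X)) by exact: measurable_carrier.
have mf : measurable_fun (A : set (borel X)) (EFin \o f).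
  exact: measurable_fun_carrier.
have f0' : forall x : borel X, A x -> (0 <= (f x)%:E)%E.
  by move=> x _; rewrite lee_fin.
rewrite ge0_integral_measure_series//.
apply: eq_eseriesr => a _; rewrite ge0_integral_mscale//.
rewrite ge0_integral_measure_sum//.
rewrite /tier_sum EFinM -sumEFin; congr (_ * _)%E; apply: eq_bigr => k _.
by rewrite integral_dirac.
Qed.
End carrier.

Lemma nneseries_finite (R : realType) (F : nat -> R) (N : nat) :
  (forall a, 0 <= F a) -> (forall a, (N <= a)%N -> F a = 0) ->
  (\sum_(a <oo) (F a)%:E = (\sum_(a < N) F a)%:E)%E.
Proof.
move=> F0 FN; rewrite (nneseries_split 0 N)//; last by move=> k _; rewrite lee_fin.
rewrite add0n eseries0 ?adde0; last by move=> k Nk _; rewrite FN.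
by rewrite big_mkord sumEFin.
Qed.

Lemma normc_ge0 (R : realType) (z : R[i]) : 0 <= Normc.normc z.
Proof. by rewrite /Normc.normc; case: z => a b; exact: sqrtr_ge0. Qed.

(** * Balls of finite measure and pointwise bounds for the maximal function *)

Section maximal_bounds.
Context (R : realType) (T : layout R).
Local Notation e := (lexp T).
Local Notation m a := (lmass T a)%:num.
Local Notation X := (layout_space T).
Implicit Types (x y : carrier T) (f : carrier T -> R).

Lemma tier_sum_ge0 f a : (forall x, 0 <= f x) -> 0 <= tier_sum f a.
Proof. by move=> f0; rewrite mulr_ge0// sumr_ge0. Qed.

(** Only links starting at [x] count: at a leaf this is the ball of radius 2, and at a center, once
    [center_ofP] holds, it is the single point [x]. *)
Definition neighbourhood x : set (carrier T) := [set y | y = x \/ link x y].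

(** The integral of [f] over the neighbourhood of [x], divided by the mass of [x] instead of that of
    the neighbourhood; a linear substitute for the maximal function. *)
Definition spread f x : R := f x +
  \sum_(c < x.1 | center_of T x.1 c) m c / m x.1 * f (c : nat, x.2 %% 2 ^ e c)%N.

Hypothesis center_ofP : forall a c, center_of T a c ->
  [/\ leaf T a, ~~ leaf T c & (c < a)%N].
Hypothesis inf_nonleaf : forall n, exists2 a, (n <= a)%N & ~~ leaf T a.
Hypothesis mass_ge1 : forall a, 1 <= m a.

(** All the points [(a, 0)] are active and have mass at least 1, so infinitely many of them push the
    partial sums beyond every integer. *)
Lemma measure_pinfty (A : set (carrier T)) :
  (forall n, exists2 a, (n <= a)%N & A (a, 0)%N) -> mms_measure X A = +oo%E.
Proof.
move=> infA; rewrite carrier_measureE; apply/eqyP => r r0.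
have t0 a : 0 <= tier_sum \1_A a by exact: tier_sum_ge0.
have [N rN] : exists N, r <= \sum_(a < N) tier_sum \1_A a.
  suff H k : exists N, k%:R <= \sum_(a < N) tier_sum \1_A a.
    have [N rN] := H (Num.truncn r).+1; exists N.
    by rewrite (le_trans _ rN)// ltW// truncnS_gt.
  elim: k => [|k [N kN]]; first by exists 0%N; rewrite big_ord0.
  have [a Na Aa] := infA N; exists a.+1.
  rewrite big_ord_recr/= -natr1 lerD//.
    rewrite (le_trans kN)// -(big_mkord xpredT (tier_sum \1_A)).
    rewrite -(big_mkord xpredT (tier_sum \1_A)) (big_cat_nat _ Na)//= lerDl.
    exact: sumr_ge0.
  rewrite /tier_sum -[leLHS]mulr1 ler_pM//.
  have [j je] : {j : 'I_(2 ^ e a) | j = 0%N :> nat}.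
    by exists (Ordinal (expn_gt0 2 (e a))).
  rewrite (bigD1 j)//= je indicE mem_set// lerDl sumr_ge0//.
apply: (@le_trans _ _ (\sum_(0 <= a < N) (tier_sum \1_A a)%:E)%E).
  by rewrite big_mkord sumEFin lee_fin.
by apply: nneseries_lim_ge => a _ _; rewrite lee_fin.
Qed.

Lemma measure_ge_mass x (A : set (carrier T)) : (x.2 < 2 ^ e x.1)%N -> A x ->
  ((m x.1)%:E <= mms_measure X A)%E.
Proof.
move=> xe Ax; rewrite carrier_measureE.
have t0 a : 0 <= tier_sum \1_A a by exact: tier_sum_ge0.
apply: (@le_trans _ _ (\sum_(0 <= a < x.1.+1) (tier_sum \1_A a)%:E)%E); last first.
  by apply: nneseries_lim_ge => a _ _; rewrite lee_fin.
rewrite big_mkord sumEFin lee_fin big_ord_recr/=.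
apply: (@le_trans _ _ (tier_sum \1_A x.1)); last first.
  by rewrite lerDr sumr_ge0.
rewrite /tier_sum ler_pMr// (bigD1 (Ordinal xe))//=.
by rewrite -surjective_pairing indicE mem_set// lerDl sumr_ge0.
Qed.

(** A neighbourhood has at most one point in each tier: a link determines the second coordinate of
    its target, and the center tiers differ from the tier of [x]. *)
Lemma tier_sum_neighbourhood x f a : (x.2 < 2 ^ e x.1)%N ->
  tier_sum (fun y => \1_(neighbourhood x) y * f y) a =
  (if a == x.1 then m x.1 * f x else 0) +
  (if center_of T x.1 a then m a * f (a, x.2 %% 2 ^ e a)%N else 0).
Proof.
move=> xe; rewrite /tier_sum.
have pick (j : nat) : (j < 2 ^ e a)%N ->
    (forall k, neighbourhood x (a, k) <-> k = j) ->
    \sum_(k < 2 ^ e a) \1_(neighbourhood x) (a, k : nat) * f (a, k : nat) = f (a, j).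
  move=> ja H; rewrite (bigD1 (Ordinal ja))//= big1 ?addr0.
    by rewrite indicE mem_set ?mul1r//; exact/H.
  move=> k /eqP kj; rewrite indicE memNset ?mul0r// => /H kj'.
  by apply: kj; exact: val_inj.
have [ax|ax] := eqVneq a x.1.
  have nc : center_of T x.1 a = false.
    by rewrite ax; apply/negP => /center_ofP[_ _]; rewrite ltnn.
  rewrite nc addr0 (pick x.2); first by rewrite ax -surjective_pairing.
    by rewrite ax.
  move=> k; split=> [[<-//|]|->]; first by rewrite /link/= nc.
  by left; rewrite ax -surjective_pairing.
rewrite add0r; case: ifPn => ca.
  rewrite (pick (x.2 %% 2 ^ e a)%N)//; first by rewrite ltn_mod expn_gt0.
  move=> k; split=> [[xE|]|->]; first by rewrite -xE eqxx in ax.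
    by rewrite /link/= ca => /eqP.
  by right; rewrite /link/= ca eqxx.
rewrite big1 ?mulr0// => k _; rewrite indicE memNset ?mul0r// => -[xE|].
  by rewrite -xE eqxx in ax.
by rewrite /link/= (negbTE ca).
Qed.

Lemma neighbourhood_integral x f : (x.2 < 2 ^ e x.1)%N -> (forall y, 0 <= f y) ->
  (\int[mms_measure X]_(y in neighbourhood x) (f y)%:E =
   (m x.1 * spread f x)%:E)%E.
Proof.
move=> xe f0; rewrite carrier_integralE// (nneseries_finite (N := x.1.+1)).
- congr (_%:E); rewrite /spread mulrDr mulr_sumr.
  under eq_bigr do rewrite tier_sum_neighbourhood//.
  rewrite big_split/=; congr (_ + _).
    by rewrite big_ord_recr/= eqxx big1 ?add0r// => c _; rewrite ltn_eqF.
  rewrite big_ord_recr/=.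
  have -> : center_of T x.1 x.1 = false.
    by apply/negP => /center_ofP[_ _]; rewrite ltnn.
  rewrite addr0 [RHS]big_mkcond/=; apply: eq_bigr => c _; case: ifP => // _.
  by rewrite !mulrA [m x.1 * _]mulrC mulfK.
- by move=> a; apply: tier_sum_ge0 => y; rewrite mulr_ge0.
- move=> a xa; rewrite tier_sum_neighbourhood// gtn_eqF// add0r.
  by case: ifPn => // /center_ofP[_ _]; rewrite ltnNge ltnW.
Qed.

Lemma neighbourhood_measure x : (x.2 < 2 ^ e x.1)%N ->
  mms_measure X (neighbourhood x) = (m x.1 * spread (cst 1) x)%:E.
Proof.
move=> xe; rewrite -neighbourhood_integral//.
transitivity (\int[mms_measure X]_(y in neighbourhood x) cst 1%E y)%E => //.
by rewrite integral_cst ?mul1e//; exact: measurable_carrier.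
Qed.

Lemma ball_neighbourhood x s : s <= 1 \/ leaf T x.1 /\ s <= 2 ->
  @ball R X x s `<=` neighbourhood x.
Proof.
move=> sx y; rewrite ball_gdist/= /gdist.
case: eqP => [<-|xy]; first by left.
rewrite /gadjacent; case: sx => [s1|[lx s2]].
  by case: ifP => _; lra.
rewrite lx/=; case: ifPn => [/orP[lxy|]|]; [by right| |lra].
by move=> /andP[/center_ofP[_]]; rewrite lx.
Qed.

Lemma neighbourhood_ball x s : 1 < s -> neighbourhood x `<=` @ball R X x s.
Proof.
move=> s1 y; rewrite ball_gdist/= /gdist => -[->|xy]; first by rewrite eqxx; lra.
by case: ifP => _; [lra|rewrite /gadjacent xy orbT].
Qed.

(** Such a ball contains all the points of the infinitely many nonleaf tiers, since these are
    pairwise adjacent. *)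
Lemma nonleaf_ball x s : ~~ leaf T x.1 -> 1 < s ->
  mms_measure X (@ball R X x s) = +oo%E.
Proof.
move=> lx s1; apply: measure_pinfty => n; have [a na la] := inf_nonleaf n.
exists a => //; rewrite ball_gdist/= /gdist/gadjacent.
by case: ifP => _; [lra|rewrite lx la].
Qed.

Lemma big_ball x s : 2 < s -> mms_measure X (@ball R X x s) = +oo%E.
Proof.
move=> s2; apply: measure_pinfty => n; have [a na la] := inf_nonleaf n.
exists a => //; rewrite ball_gdist/= /gdist.
by case: ifP => _; [lra|case: ifP => _; lra].
Qed.

(** Averages over balls of infinite measure are 0; every other ball lies in the neighbourhood and
    has at least the mass of its own center point. *)
Lemma average_le_spread (f : X -> R[i]) x s : (x.2 < 2 ^ e x.1)%N -> 0 < s ->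
  (average f (ball x s) <= (spread (fun y => Normc.normc (f y)) x)%:E)%E.
Proof.
move=> xe s0; set g := fun y => Normc.normc (f y).
have g0 y : 0 <= g y by exact: normc_ge0.
have sp0 : 0 <= spread g x.
  by rewrite addr_ge0// sumr_ge0// => c _; rewrite mulr_ge0// divr_ge0.
rewrite /average; case: ifPn => [_|]; first by rewrite lee_fin.
rewrite negb_or => /andP[mu0 muoo].
have sx : s <= 1 \/ leaf T x.1 /\ s <= 2.
  case: (leP s 1) => [|s1]; first by left.
  case: (boolP (leaf T x.1)) => [lx|lx]; last first.
    by rewrite nonleaf_ball ?eqxx in muoo.
  by right; split => //; rewrite leNgt; apply/negP => /(big_ball x) muoo';
     rewrite muoo' eqxx in muoo.
have mge : ((m x.1)%:E <= mms_measure X (ball x s))%E.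
  by apply: measure_ge_mass => //; rewrite ball_gdist/= /gdist eqxx.
have ile : (\int[mms_measure X]_(y in ball x s) modulus f y <=
            (m x.1 * spread g x)%:E)%E.
  rewrite -neighbourhood_integral//; apply: ge0_subset_integral => //.
  - exact: measurable_carrier.
  - exact: measurable_carrier.
  - exact: measurable_fun_carrier.
  - by move=> y _; rewrite lee_fin; exact: g0.
  - exact: ball_neighbourhood.
move: (mms_measure X _) mu0 muoo mge => [r| |]//= mu0 _; rewrite lee_fin => mr.
have r0 : 0 < r by apply: lt_le_trans mr.
rewrite inver gt_eqF//.
apply: (le_trans (lee_wpmul2l _ ile)); first by rewrite lee_fin invr_ge0 ltW.
by rewrite -EFinM lee_fin mulrA ler_piMl// mulrC ler_pdivrMr// mul1r.
Qed.

Lemma maximal_le_spread (f : X -> R[i]) x : (x.2 < 2 ^ e x.1)%N ->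
  (maximal f x <= (spread (fun y => Normc.normc (f y)) x)%:E)%E.
Proof. by move=> xe; apply: ge_ereal_sup => _ [s s0 <-]; exact: average_le_spread. Qed.

(** The ball of radius 2 is exactly the neighbourhood, and the mass hypothesis bounds its measure by
    twice the mass of [x]. *)
Lemma spread_le_maximal (f : X -> R[i]) x : (x.2 < 2 ^ e x.1)%N -> leaf T x.1 ->
  \sum_(c < x.1 | center_of T x.1 c) m c <= m x.1 ->
  ((2^-1 * spread (fun y => Normc.normc (f y)) x)%:E <= maximal f x)%E.
Proof.
move=> xe lx mle; set g := fun y => Normc.normc (f y).
have g0 y : 0 <= g y by exact: normc_ge0.
have sp0 : 0 <= spread g x.
  by rewrite addr_ge0// sumr_ge0// => c _; rewrite mulr_ge0// divr_ge0.
apply: (@le_trans _ _ (average f (ball x 2))); last first.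
  by apply: ereal_sup_ubound; exists 2 => //=; exact: ltr0n.
have -> : ball x 2 = neighbourhood x.
  apply/seteqP; split; first by apply: ball_neighbourhood; right.
  by apply: neighbourhood_ball; lra.
have muE := neighbourhood_measure xe.
have s1 : 1 <= spread (cst 1) x <= 2.
  rewrite /spread/=; under eq_bigr do rewrite mulr1.
  rewrite lerDl sumr_ge0 => [|c _]; last by rewrite divr_ge0.
  by rewrite -mulr_suml lerD2l ler_pdivrMr// mul1r.
have m0 : 0 < m x.1 * spread (cst 1) x.
  by rewrite mulr_gt0//; case/andP: s1 => s1 _; apply: lt_le_trans s1.
rewrite /average muE orbF eqe gt_eqF// neighbourhood_integral// inver gt_eqF//.
rewrite -EFinM lee_fin invfM mulrACA mulVf// mul1r ler_wpM2r//.
by case/andP: s1 => s1 s2; rewrite lef_pV2 ?posrE ?ltr0n// (lt_le_trans _ s1).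
Qed.

(** At a nonleaf point the ball of radius 1 has finite measure and the ball of radius 2 infinite
    measure. *)
Lemma layout_not_doubling : ~ doubling X.
Proof.
case=> C /(_ _ _ ltr01); have [a _ la] := inf_nonleaf 0; move=> /(_ ((a, 0)%N : X)).
rewrite nonleaf_ball//; last by lra.
have : (mms_measure X (ball ((a, 0)%N : X) 1) < +oo)%E.
  apply: (@le_lt_trans _ _ (mms_measure X (neighbourhood (a, 0)%N))).
    apply: le_measure; rewrite ?inE; [exact: measurable_carrier..|].
    by apply: ball_neighbourhood; left.
  by rewrite neighbourhood_measure ?ltry ?expn_gt0.
have : (0 <= mms_measure X (ball ((a, 0)%N : X) 1))%E by exact: measure_ge0.
by case: (mms_measure X _).
Qed.
End maximal_bounds.

(** * Decreasing rearrangement on the tiers *)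

Section ranking.
Context (R : realType) (g : nat -> R) (n : nat).

Definition ranking : seq nat := sort (fun i j => g j <= g i) (iota 0 n).

Definition ranked (k : nat) : R := g (nth 0%N ranking k).

Lemma size_ranking : size ranking = n.
Proof. by rewrite size_sort size_iota. Qed.

Lemma perm_ranking : perm_eq ranking (iota 0 n).
Proof. by rewrite perm_sort. Qed.

Lemma ranked_noninc i j : (i <= j < n)%N -> ranked j <= ranked i.
Proof.
move=> /andP[ij jn].
have s : sorted (fun i j => g j <= g i) ranking.
  by apply: sort_sorted => a b; exact: le_total.
have tr : transitive (fun i j => g j <= g i) by move=> a b c ba ac; exact: le_trans ac ba.
have rf : reflexive (fun i j => g j <= g i) by move=> a /=.
apply: (sorted_leq_nth tr rf 0%N s) => //; rewrite inE size_ranking//.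
exact: leq_ltn_trans jn.
Qed.

Lemma big_ranking (V : Type) (idx : V) (op : Monoid.com_law idx) (F : nat -> V) :
  \big[op/idx]_(k < n) F k = \big[op/idx]_(k < n) F (nth 0%N ranking k).
Proof.
rewrite -(big_mkord xpredT F) /index_iota subn0.
rewrite -(perm_big _ perm_ranking)/= (big_nth 0%N) size_ranking.
by rewrite big_mkord.
Qed.

(** The ranked values do not increase, so those that are at least [t] fill an initial segment of the
    ranks, whose length can be counted in any order. *)
Lemma le_rankedE k t : (k < n)%N ->
  (t <= ranked k) = (k < \sum_(i < n) (t <= g i)%R)%N.
Proof.
move=> kn; have -> : (\sum_(i < n) (t <= g i)%R = \sum_(i < n) (t <= ranked i)%R)%N.
  exact: (big_ranking _ (fun i => (t <= g i)%R : nat)).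
rewrite -(big_mkord xpredT (fun i => (t <= ranked i)%R : nat)).
have [tk|tk] := boolP (t <= ranked k); apply/esym.
  rewrite (big_cat_nat (n := k.+1))//=; apply: leq_trans (leq_addr _ _).
  rewrite (eq_big_nat _ _ (F2 := fun=> 1%N)); first by rewrite sum_nat_const_nat muln1.
  move=> i /andP[_ ik]; rewrite (le_trans tk)// ranked_noninc//.
  by rewrite -ltnS ik.
apply/negbTE; rewrite -leqNgt (big_cat_nat (n := k))//=; last exact: ltnW.
have -> : (\sum_(k <= i < n) (t <= ranked i)%R = 0)%N.
  rewrite big_nat_cond big1// => i /andP[/andP[ki kin] _].
  apply/eqP; rewrite eqb0 -ltNge.
  by rewrite (le_lt_trans (ranked_noninc (i := k) _)) ?ki// ltNge.
rewrite addn0 (leq_trans (n := (\sum_(0 <= i < k) 1)%N))//.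
  by apply: leq_sum => i _; exact: leq_b1.
by rewrite sum_nat_const_nat muln1 subn0.
Qed.

End ranking.

Lemma powR2N_lt1 (R : realType) (theta : R) : 0 < theta -> 2 `^ (- theta) < 1.
Proof.
move=> t0; rewrite powRN invf_lt1 ?powR_gt0//.
have : 1 `^ theta < 2 `^ theta :> R.
  by apply: gt0_ltr_powR; rewrite ?nnegrE// ltr1n.
by rewrite powR1.
Qed.

(** * Lacunary masses and level sets *)

Section dyadic_masses.
Context (R : realType) (T : layout R).
Local Notation e := (lexp T).
Local Notation m a := (lmass T a)%:num.

(** Since [m i * 2 ^+ e i] is the total mass of tier [i], a single point weighs at least twice as
    much as all the earlier tiers together. *)
Definition lacunary := forall a, 2 * (\sum_(i < a) m i * 2 ^+ e i) <= m a.

(** The mass of [2 ^ b] points of tier [a]. *)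
Definition block_mass a b : R := m a * 2 ^+ b.

Lemma block_mass_gt0 a b : 0 < block_mass a b.
Proof. by rewrite mulr_gt0// exprn_gt0. Qed.

Hypothesis lac : lacunary.

Lemma block_mass_lt a b a' b' : (a < a')%N -> (b <= e a)%N ->
  2 * block_mass a b <= block_mass a' b'.
Proof.
move=> aa be; apply: (@le_trans _ _ (m a')); last first.
  by rewrite ler_peMr// exprn_ege1// ler1n.
apply: le_trans (lac a'); rewrite ler_pM2l// (bigD1 (Ordinal aa))//=.
apply: (@le_trans _ _ (m a * 2 ^+ e a)); last by rewrite lerDl sumr_ge0.
by rewrite ler_pM2l// ler_weXn2l// ler1n.
Qed.

Lemma sum_block_mass_powR (theta D : R) A : 0 < theta -> 0 <= D ->
  \sum_(a < A) \sum_(b < (e a).+1)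
    (if block_mass a b <= D then block_mass a b `^ theta else 0)
  <= (1 - 2 `^ (- theta))^-1 * D `^ theta.
Proof.
move=> t0; set C := (_^-1).
have r1 := powR2N_lt1 t0.
have C0 : 0 < C by rewrite invr_gt0 subr_gt0.
(* This identity determines [C] and closes the induction: the largest term is split off and [D] is
   halved for the rest. *)
have CE D' : 0 <= D' -> C * (D' / 2) `^ theta + D' `^ theta = C * D' `^ theta.
  move=> D0; rewrite powRM ?invr_ge0// -powR_inv1// -powRrM mulN1r /C.
  by field; rewrite gt_eqF// subr_gt0.
elim: A D => [|A IH] D D0; first by rewrite big_ord0 mulr_ge0 ?powR_ge0// ltW.
rewrite big_ord_recr/=.
suff H B : (B <= (e A).+1)%N -> forall D, 0 <= D ->
    \sum_(a < A) \sum_(b < (e a).+1)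
      (if block_mass a b <= D then block_mass a b `^ theta else 0) +
    \sum_(b < B) (if block_mass A b <= D then block_mass A b `^ theta else 0)
    <= C * D `^ theta by exact: H.
elim: B => [|B IHB] BA {}D {}D0.
  by rewrite big_ord0 addr0 IH.
rewrite big_ord_recr/=; case: ifPn => [MD|_]; last first.
  by rewrite addr0 IHB// ltnW.
have D2 : 0 <= D / 2 by rewrite divr_ge0.
(* Every block mass before [block_mass A B] is at most half of it, so the cutoff [D] can be lowered
   to [D / 2] for them. *)
have H x : 2 * x <= block_mass A B -> (x <= D) = (x <= D / 2).
  move=> xM; have xD : 2 * x <= D := le_trans xM MD.
  have xD2 : x <= D / 2 by lra.
  by rewrite xD2; apply: le_trans xD2 _; lra.
apply: (@le_trans _ _ (C * (D / 2) `^ theta + D `^ theta)); last by rewrite CE.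
rewrite addrA lerD//; last by rewrite ge0_ler_powR// ?nnegrE ltW// block_mass_gt0.
apply: le_trans (IHB (ltnW BA) _ D2); rewrite lerD//.
  apply: ler_sum => a _; apply: ler_sum => b _; rewrite H//.
  by apply: block_mass_lt => //; rewrite -ltnS.
apply: ler_sum => b _; rewrite H// /block_mass.
rewrite mulrCA ler_pM2l// -exprS ler_weXn2l// ?ler1n//.
Qed.

Section level_sets.
Variable h : carrier T -> R.

Definition level_card a (t : R) : nat :=
  (\sum_(k < 2 ^ e a) (t <= h (a, k : nat))%R)%N.

(** Ranks start at 0, so this is the [2 ^ b]-th largest value of [h] on tier [a]. *)
Definition star a b : R := ranked (fun k => h (a, k)) (2 ^ e a) (2 ^ b).-1.

Lemma le_starE a b t : (b <= e a)%N -> (t <= star a b) = (2 ^ b <= level_card a t)%N.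
Proof.
by move=> be; rewrite /star le_rankedE prednK ?expn_gt0 ?leq_exp2l.
Qed.

Lemma level_card_le a t : (level_card a t <= 2 ^ e a)%N.
Proof.
rewrite -[leqRHS]card_ord -sum1_card; apply: leq_sum => i _; exact: leq_b1.
Qed.

Lemma star_ge0 a b : (forall x, 0 <= h x) -> 0 <= star a b.
Proof. by move=> h0; exact: h0. Qed.

(** The last tier that meets the level set dominates: with [b] the integer part of the binary
    logarithm of its count it contributes less than [2 * block_mass a b], and all the earlier tiers
    together at most half the mass of one of its points. *)
Lemma partial_mass_le A t : (\sum_(a < A) m a * (level_card a t)%:R = 0) \/
  exists a b, [/\ (a < A)%N, (b <= e a)%N, t <= star a b &
    \sum_(a < A) m a * (level_card a t)%:R <= 4 * block_mass a b].
Proof.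
elim: A => [|A IH]; first by left; rewrite big_ord0.
rewrite big_ord_recr/=; have [->|c0] := posnP (level_card A t).
  rewrite mulr0 addr0; case: IH => [|[a [b [aA be tb S]]]]; first by left.
  by right; exists a, b; split=> //; exact: ltnW.
right; exists A, (trunc_log 2 (level_card A t)).
have lo := @trunc_logP 2 (level_card A t) isT c0.
have up := @trunc_log_ltn 2 (level_card A t) isT.
have be : (trunc_log 2 (level_card A t) <= e A)%N.
  by rewrite -(@leq_exp2l 2)// (leq_trans lo)// level_card_le.
split=> //; first by rewrite le_starE.
have S : 2 * (\sum_(a < A) m a * (level_card a t)%:R) <= m A.
  apply: le_trans (lac A); rewrite ler_pM2l// ler_sum// => a _.
  by rewrite ler_pM2l// -natrX ler_nat level_card_le.
have U : (level_card A t)%:R <= 2 ^+ (trunc_log 2 (level_card A t)).+1 :> R.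
  by rewrite -natrX ler_nat ltnW.
have U1 : 1 <= 2 ^+ (trunc_log 2 (level_card A t)) :> R by rewrite exprn_ege1// ler1n.
have m0 : 0 < m A by [].
rewrite exprS in U; rewrite /block_mass.
have : m A * (level_card A t)%:R <= m A * (2 * 2 ^+ trunc_log 2 (level_card A t)).
  by rewrite ler_pM2l.
have : m A * 1 <= m A * 2 ^+ (trunc_log 2 (level_card A t)) by rewrite ler_pM2l.
lra.
Qed.

Definition level_mass (t : R) : \bar R :=
  (\sum_(a <oo) (m a * (level_card a t)%:R)%:E)%E.

Lemma dist_funE t : (forall x, 0 <= h x) ->
  dist_fun (X := layout_space T) (EFin \o h) t = level_mass t.
Proof.
move=> h0; rewrite /dist_fun carrier_measureE; apply: eq_eseriesr => a _.
congr (_%:E); rewrite /tier_sum/level_card natr_sum; congr (_ * _).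
apply: eq_bigr => k _; rewrite indicE/=; congr (_%:R); congr nat_of_bool.
apply/idP/idP; first by move=> /set_mem/=; rewrite ger0_norm// lee_fin.
by move=> th; apply/mem_set; rewrite /= ger0_norm// lee_fin.
Qed.

Lemma level_mass_ge a b t : (b <= e a)%N -> t <= star a b ->
  ((block_mass a b)%:E <= level_mass t)%E.
Proof.
move=> be tb; apply: (@le_trans _ _
    (\sum_(0 <= i < a.+1) (m i * (level_card i t)%:R)%:E)%E); last first.
  by apply: nneseries_lim_ge => i _ _; rewrite lee_fin mulr_ge0.
rewrite big_mkord sumEFin lee_fin big_ord_recr/=.
apply: (@le_trans _ _ (m a * (level_card a t)%:R)).
  by rewrite ler_pM2l// -natrX ler_nat -le_starE.
by rewrite lerDr sumr_ge0// => i _; rewrite mulr_ge0.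
Qed.

Lemma level_mass_le t (B : R) : 0 <= B ->
  (forall a b, (b <= e a)%N -> t <= star a b -> 4 * block_mass a b <= B) ->
  (level_mass t <= B%:E)%E.
Proof.
move=> B0 H; apply: lime_le.
  by apply: is_cvg_nneseries => i _ _; rewrite lee_fin mulr_ge0.
apply: nearW => A; rewrite big_mkord sumEFin lee_fin.
case: (partial_mass_le A t) => [->//|[a [b [aA be tb S]]]].
exact: le_trans S (H _ _ be tb).
Qed.

Lemma level_mass_ge0 t : (0 <= level_mass t)%E.
Proof. by apply: nneseries_ge0 => i _ _; rewrite lee_fin mulr_ge0. Qed.

Lemma measurable_level_mass (D : set R) : measurable D -> measurable_fun D level_mass.
Proof.
move=> mD; rewrite /level_mass.
apply: ge0_emeasurable_sum => [k x _ _|k _]; first by rewrite lee_fin mulr_ge0.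
apply/measurable_EFinP; apply: measurable_funM => //.
under eq_fun do rewrite /level_card natr_sum.
apply: measurable_sum => i; rewrite (_ : (fun x => _) = \1_(`]-oo, h (k, i : nat)])).
  by apply: measurable_indic.
apply/funext => t; rewrite indicE; congr (nat_of_bool _)%:R.
by apply/idP/idP; rewrite inE/= in_itv.
Qed.

End level_sets.
End dyadic_masses.

(** * Lorentz norms *)

Section lorentz_discretization.
Context (R : realType) (T : layout R) (p : R).
Local Notation e := (lexp T).
Local Notation m a := (lmass T a)%:num.
Local Notation X := (layout_space T).
Hypothesis p1 : 1 < p.
Hypothesis lac : lacunary T.
Implicit Type h : carrier T -> R.

Definition profile h a b : R := block_mass T a b `^ p^-1 * star h a b.

(** The l^q norm of [x] over the pairs with [b <= e a] is at most [S], expressed through finite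
    partial sums over the tiers; the value at [-oo] is a dummy. *)
Definition lq_bounded (q : \bar R) (x : nat -> nat -> R) (S : R) : Prop :=
  match q with
  | q'%:E => forall A, \sum_(a < A) \sum_(b < (e a).+1) x a b `^ q' <= S `^ q'
  | +oo%E => forall a b, (b <= e a)%N -> x a b <= S
  | -oo%E => True
  end.

Lemma lee_poweR (x y : \bar R) (r : R) : 0 <= r -> (0 <= x)%E -> (x <= y)%E ->
  (x `^ r <= y `^ r)%E.
Proof.
move=> r0 x0 xy; apply: gt0_ler_poweR => //; rewrite in_itv/= leey andbT//.
exact: le_trans x0 xy.
Qed.

Lemma lorentz_normE h (q : R) : (forall x, 0 <= h x) ->
  lorentz_norm (X := X) p q%:E (EFin \o h) =
  ((p `^ q^-1)%:E * (\int[lebesgue_measure]_(t in `]0%R, +oo[)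
     ((t%:E * level_mass h t `^ p^-1) `^ q * (t^-1)%:E)) `^ q^-1)%E.
Proof.
move=> h0; rewrite /lorentz_norm; congr (_ * _ `^ _)%E.
by apply: eq_integral => t _; rewrite dist_funE.
Qed.

Lemma measurable_lorentz_integrand h (q : R) :
  measurable_fun (`]0%R, +oo[ : set R)
    (fun t : R => ((t%:E * level_mass h t `^ p^-1) `^ q * (t^-1)%:E)%E).
Proof.
have mI : measurable (`]0%R, +oo[ : set R) by [].
apply: emeasurable_funM.
  have m1 := measurableT_comp (measurable_poweR p^-1) (measurable_level_mass h mI).
  have m2 : measurable_fun (`]0%R, +oo[ : set R) (EFin : R -> \bar R).
    exact/measurable_EFinP.
  exact: (measurableT_comp (measurable_poweR q) (emeasurable_funM m2 m1)).
apply/measurable_EFinP.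
apply: (eq_measurable_fun (fun t : R => t `^ (- 1))).
  by move=> t /set_mem/=; rewrite in_itv/= andbT => /ltW; exact: powR_inv1.
exact: (measurable_funTS (measurable_powR _)).
Qed.

Lemma integral_step (c s : R) (u : R) : 0 <= c -> 0 <= u -> u <= s ->
  (\int[lebesgue_measure]_(t in `]0%R, +oo[) (c * \1_(`]u, s]) t)%:E
   = (c * (s - u))%:E)%E.
Proof.
move=> c0 u0 us.
under eq_integral do rewrite EFinM.
rewrite ge0_integralZl_EFin//; last exact/measurable_EFinP.
rewrite integral_indic// setIidl; last first.
  by move=> t /=; rewrite !in_itv/= andbT => /andP[ut _]; exact: le_lt_trans ut.
rewrite /= lebesgue_measure_itv/= lte_fin EFinM; congr (_ * _)%E.
case: ltP => // su; have -> : s = u by apply/eqP; rewrite eq_le su us.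
by rewrite subrr.
Qed.

(** At each [t] the level mass is at most four times the largest block mass whose [star] reaches
    [t], so the integrand is controlled by a single step function; summing all the steps removes the
    dependence of the choice on [t]. *)
Lemma lorentz_norm_le_fin h (q S : R) : 1 <= q -> 0 <= S -> (forall x, 0 <= h x) ->
  lq_bounded q%:E (profile h) S ->
  (lorentz_norm (X := X) p q%:E (EFin \o h) <= (4 * p * S)%:E)%E.
Proof.
move=> q1 S0 h0 xS; rewrite lorentz_normE//.
have p0 : 0 < p := lt_trans ltr01 p1.
have q0 : 0 < q := lt_le_trans ltr01 q1.
(* The height is such that the step on []0, star h a b]] has integral [4]^ (q / p) * profile h a b
   [^ q]; below [star h a b] the factor [t]^ (q - 1)[of the integrand is at most]star h a b
   [^ (q - 1)]. *)
pose c a b := (4 * block_mass T a b) `^ (q / p) * star h a b `^ (q - 1).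
pose Phi a t := \sum_(b < (e a).+1) c a b * \1_(`]0, star h a b]) t.
have c0 a b : 0 <= c a b by rewrite mulr_ge0// powR_ge0.
have Phi0 a t : 0 <= Phi a t by apply: sumr_ge0 => b _; rewrite mulr_ge0.
have st0 a b : 0 <= star h a b by exact: star_ge0.
have mPhi a : measurable_fun (`]0%R, +oo[ : set R) (fun t => (Phi a t)%:E).
  apply/measurable_EFinP; apply: measurable_sum => b.
  by apply: measurable_funM.
have ptw t : 0 < t -> ((t%:E * level_mass h t `^ p^-1) `^ q * (t^-1)%:E <=
    \sum_(a <oo) (Phi a t)%:E)%E.
  move=> t0; have term a b : (b <= e a)%N ->
      ((c a b * \1_(`]0, star h a b]) t)%:E <= \sum_(a <oo) (Phi a t)%:E)%E.
    move=> be; apply: (@le_trans _ _ (\sum_(0 <= i < a.+1) (Phi i t)%:E)%E).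
      rewrite big_mkord sumEFin lee_fin big_ord_recr/=.
      rewrite ler_wpDl ?sumr_ge0// /Phi.
      have be' : (b < (e a).+1)%N by [].
      by rewrite (bigD1 (Ordinal be'))//= lerDl sumr_ge0// => i _; rewrite mulr_ge0.
    by apply: nneseries_lim_ge => i _ _; rewrite lee_fin.
  have : (0 <= \sum_(a <oo) (Phi a t)%:E)%E.
    by apply: nneseries_ge0 => i _ _; rewrite lee_fin.
  move: (\sum_(a <oo) _)%E term => [rho| |] term; [|by rewrite !leey|by rewrite leeNy_eq].
  rewrite lee_fin => rho0.
  (* [B] solves [(t * B]^ p^-1) [^ q / t = rho], so it suffices to bound the level mass by [B]. *)
  pose B := ((rho * t) `^ q^-1 / t) `^ p.
  have B0 : 0 <= B by exact: powR_ge0.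
  have lB : (level_mass h t <= B%:E)%E.
    apply: level_mass_le => // a b be tb.
    have M0 : 0 <= 4 * block_mass T a b by rewrite mulr_ge0// ltW// block_mass_gt0.
    move Q_ : (4 * block_mass T a b) M0 => Q M0.
    have := term _ _ be; rewrite /c Q_.
    rewrite indicE mem_set ?mulr1 /=; last by rewrite in_itv/= t0.
    rewrite lee_fin => H.
    have H2 : Q `^ (q / p) * t `^ q <= rho * t.
      have -> : t `^ q = t `^ (q - 1) * t.
        by rewrite mulrC mulr_powRB1// ltW.
      rewrite mulrA ler_pM2r//; apply: le_trans H; rewrite ler_wpM2l ?powR_ge0//.
      by apply: ge0_ler_powR; rewrite ?nnegrE ?subr_ge0// ltW.
    have H3 : Q `^ p^-1 * t <= (rho * t) `^ q^-1.
      have -> : Q `^ p^-1 * t =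
                (Q `^ (q / p) * t `^ q) `^ q^-1.
        rewrite powRM ?powR_ge0// -!powRrM divff ?gt_eqF// powRr1 ?ltW//.
        by congr (_ `^ _ * _); field; rewrite !gt_eqF.
      apply: ge0_ler_powR => //; rewrite ?nnegrE ?invr_ge0 ?(ltW q0)//.
        by rewrite mulr_ge0// powR_ge0.
      by rewrite mulr_ge0// ltW.
    have -> : Q = (Q `^ p^-1) `^ p.
      by rewrite -powRrM mulVf ?gt_eqF// powRr1.
    apply: ge0_ler_powR; rewrite ?nnegrE ?powR_ge0 ?(ltW p0)//.
      by rewrite divr_ge0 ?powR_ge0// ltW.
    by rewrite ler_pdivlMr.
  apply: (@le_trans _ _ ((t%:E * B%:E `^ p^-1) `^ q * (t^-1)%:E)%E).
    apply: lee_wpmul2r; first by rewrite lee_fin invr_ge0 ltW.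
    apply: lee_poweR; first exact: ltW.
      by rewrite mule_ge0 ?lee_fin ?poweR_ge0// ltW.
    apply: lee_wpmul2l; first by rewrite lee_fin ltW.
    by apply: lee_poweR => //; [rewrite invr_ge0 ltW|exact: level_mass_ge0].
  rewrite !poweR_EFin -EFinM lee_fin /B -powRrM divff ?gt_eqF//.
  rewrite powRr1 ?divr_ge0 ?powR_ge0 ?(ltW t0)//.
  rewrite [t * _]mulrC divfK ?gt_eqF// -powRrM mulVf ?gt_eqF//.
  by rewrite powRr1 ?mulr_ge0 ?(ltW t0)// mulfK// gt_eqF.
have I : (\int[lebesgue_measure]_(t in `]0%R, +oo[)
     ((t%:E * level_mass h t `^ p^-1) `^ q * (t^-1)%:E) <=
     (4 `^ (q / p) * S `^ q)%:E)%E.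
  apply: (@le_trans _ _ (\int[lebesgue_measure]_(t in `]0%R, +oo[)
     (\sum_(a <oo) (Phi a t)%:E))%E).
    apply: ge0_le_integral => //.
    - move=> t; rewrite /= in_itv/= andbT => t0; rewrite mule_ge0 ?poweR_ge0//.
      by rewrite lee_fin invr_ge0 ltW.
    - exact: measurable_lorentz_integrand.
    - by apply: ge0_emeasurable_sum => [k x _ _|k _]; rewrite ?lee_fin //; exact: mPhi.
    - by move=> t; rewrite /= in_itv/= andbT => t0; exact: ptw.
  rewrite integral_nneseries//; last by move=> n t _; rewrite lee_fin.
  rewrite (eq_eseriesr (g := fun a =>
      (4 `^ (q / p) * \sum_(b < (e a).+1) profile h a b `^ q)%:E)); last first.
    move=> a _; rewrite /Phi; under eq_integral do rewrite -sumEFin.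
    rewrite ge0_integral_sum//; last 2 first.
    - by move=> b; apply/measurable_EFinP; apply: measurable_funM.
    - by move=> b t _; rewrite lee_fin mulr_ge0.
    under eq_bigr do rewrite integral_step// subr0.
    rewrite sumEFin mulr_sumr; congr (_%:E); apply: eq_bigr => b _.
    rewrite /c /profile -mulrA [_ * star _ _ _]mulrC mulr_powRB1//.
    move: (block_mass T a b) (block_mass_gt0 T a b) => M /ltW M0.
    rewrite powRM// [in RHS]powRM ?powR_ge0// -powRrM mulrA.
    by rewrite [p^-1 * q]mulrC.
  apply: lime_le.
    apply: is_cvg_nneseries => i _ _; rewrite lee_fin mulr_ge0 ?powR_ge0//.
    by rewrite sumr_ge0// => b _; exact: powR_ge0.
  apply: nearW => A; rewrite big_mkord sumEFin lee_fin -mulr_sumr.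
  by rewrite ler_wpM2l ?powR_ge0.
apply: (@le_trans _ _ ((p `^ q^-1)%:E * (4 `^ (q / p) * S `^ q)%:E `^ q^-1)%E).
  rewrite lee_wpmul2l ?lee_fin ?powR_ge0// lee_poweR// ?invr_ge0 ?(ltW q0)//.
  apply: integral_ge0 => t; rewrite /= in_itv/= andbT => t0.
  by rewrite mule_ge0 ?poweR_ge0// lee_fin invr_ge0 ltW.
rewrite poweR_EFin -EFinM lee_fin powRM ?powR_ge0// -!powRrM.
rewrite divff ?gt_eqF// powRr1// mulrA ler_wpM2r// mulrC ler_pM ?powR_ge0//.
  rewrite -[leRHS]powRr1//; apply: ler_powR; first by rewrite ler1n.
  have -> : q / p / q = p^-1 by field; rewrite !gt_eqF.
  by rewrite invf_le1// ltW.
rewrite -[leRHS]powRr1 ?(ltW p0)//; apply: ler_powR; first exact: ltW.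
by rewrite invf_le1.
Qed.

(** Conversely the integrand dominates a finite sum of steps: those that are nonzero at [t] have
    block masses at most the level mass, so [sum_block_mass_powR] bounds all of them at once by the
    largest. *)
Lemma lorentz_norm_ge_fin (q : R) : 1 <= q -> exists2 C : R, 0 <= C &
  forall h V, (forall x, 0 <= h x) -> 0 <= V ->
  (lorentz_norm (X := X) p q%:E (EFin \o h) <= V%:E)%E ->
  lq_bounded q%:E (profile h) (C * V).
Proof.
move=> q1.
have p0 : 0 < p := lt_trans ltr01 p1.
have q0 : 0 < q := lt_le_trans ltr01 q1.
have qp0 : 0 < q / p by rewrite divr_gt0.
pose C0 : R := (1 - 2 `^ (- (q / p)))^-1.
have C00 : 0 < C0 by rewrite invr_gt0 subr_gt0 powR2N_lt1.
exists (2 * C0 `^ q^-1); first by rewrite mulr_ge0// powR_ge0.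
move=> h V h0 V0; rewrite lorentz_normE//; set I := (\int[_]_(_ in _) _)%E => IV A.
have st0 a b : 0 <= star h a b by exact: star_ge0.
have M0 a b := ltW (block_mass_gt0 T a b).
(* The steps live on the upper halves []star / 2, star]], where [t]^ (q - 1)[is at least](star / 2)
   [^ (q - 1)]; halving costs only a factor depending on [q]. *)
pose c a b := block_mass T a b `^ (q / p) * (star h a b / 2) `^ (q - 1).
have c0 a b : 0 <= c a b by rewrite mulr_ge0// powR_ge0.
pose Psi t := \sum_(a < A) \sum_(b < (e a).+1)
  c a b * \1_(`]star h a b / 2, star h a b]) t.
have I0 : (0 <= I)%E.
  apply: integral_ge0 => t; rewrite /= in_itv/= andbT => t0.
  by rewrite mule_ge0 ?poweR_ge0// lee_fin invr_ge0 ltW.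
have IVq : (I <= (V `^ q)%:E)%E.
  have IV' : (I `^ q^-1 <= V%:E)%E.
    apply: le_trans IV; rewrite -[leLHS]mul1e lee_wpmul2r ?poweR_ge0// lee_fin.
    rewrite -[leLHS](powRr0 p); apply: ler_powR; first exact: ltW.
    by rewrite invr_ge0 ltW.
  have -> : I = ((I `^ q^-1) `^ q)%E.
    by rewrite -poweRrM mulVf ?gt_eqF// poweRe1.
  by rewrite -poweR_EFin lee_poweR ?poweR_ge0// ltW.
have ptw t : 0 < t -> ((Psi t)%:E <=
    C0%:E * ((t%:E * level_mass h t `^ p^-1) `^ q * (t^-1)%:E))%E.
  move=> t0; have := fun a b => @level_mass_ge _ _ h a b t.
  have := level_mass_ge0 h t.
  case: (level_mass h t) => [d| |]//; last first.
    move=> _ _; rewrite poweRyr ?invr_neq0 ?gt_eqF// gt0_muley ?lte_fin//.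
    rewrite poweRyr ?gt_eqF// gt0_mulye ?lte_fin ?invr_gt0//.
    by rewrite gt0_muley ?leey// lte_fin.
  rewrite lee_fin => d0 Md.
  rewrite !poweR_EFin -!EFinM lee_fin.
  have -> : (t * d `^ p^-1) `^ q / t = t `^ (q - 1) * d `^ (q / p).
    rewrite powRM ?powR_ge0 ?(ltW t0)// -powRrM [p^-1 * q]mulrC.
    rewrite -[t `^ q]mulr_powRB1 ?(ltW t0)//; field.
    by rewrite gt_eqF.
  rewrite mulrCA; apply: (@le_trans _ _ (t `^ (q - 1) *
      \sum_(a < A) \sum_(b < (e a).+1)
      (if block_mass T a b <= d then block_mass T a b `^ (q / p) else 0))).
    rewrite /Psi mulr_sumr; apply: ler_sum => a _.
    rewrite mulr_sumr; apply: ler_sum => b _; rewrite indicE.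
    have [|_] := boolP (t \in _); last first.
      by rewrite mulr0; case: ifP => _; rewrite ?mulr0// mulr_ge0// powR_ge0.
    move=> /set_mem/=; rewrite in_itv/= => /andP[st ts].
    have be : (b <= e a)%N by rewrite -ltnS.
    have := Md _ _ be ts; rewrite lee_fin => ->.
    rewrite mulr1 /c mulrC ler_wpM2r ?powR_ge0//.
    by apply: ge0_ler_powR; rewrite ?nnegrE ?subr_ge0 ?divr_ge0// ltW.
  rewrite ler_wpM2l ?powR_ge0//.
  exact: sum_block_mass_powR.
have mc a b : measurable_fun (`]0%R, +oo[ : set R)
    (fun t => c a b * \1_(`]star h a b / 2, star h a b]) t).
  by apply: measurable_funM.
have IPsi : (\int[lebesgue_measure]_(t in `]0%R, +oo[) (Psi t)%:E =
    (2 `^ (- q) * \sum_(a < A) \sum_(b < (e a).+1) profile h a b `^ q)%:E)%E.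
  rewrite /Psi; under eq_integral do rewrite -sumEFin.
  rewrite ge0_integral_sum//; last 2 first.
  - by move=> a; apply/measurable_EFinP; apply: measurable_sum => b; exact: mc.
  - by move=> a t _; rewrite lee_fin sumr_ge0// => b _; rewrite mulr_ge0.
  rewrite mulr_sumr -sumEFin; apply: eq_bigr => a _.
  under eq_integral do rewrite -sumEFin.
  rewrite ge0_integral_sum//; last 2 first.
  - by move=> b; apply/measurable_EFinP; exact: mc.
  - by move=> b t _; rewrite lee_fin mulr_ge0.
  rewrite mulr_sumr -sumEFin; apply: eq_bigr => b _.
  rewrite integral_step ?divr_ge0 ?ler_piMr ?invf_le1 ?ler1n//; congr (_%:E).
  have -> : star h a b - star h a b / 2 = star h a b / 2 by field.
  rewrite /c /profile -mulrA [_ * (star _ _ _ / 2)]mulrC mulr_powRB1 ?divr_ge0//.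
  move: (block_mass T a b) (M0 a b) => M {}M0.
  rewrite powRM// ?invr_ge0// [in RHS]powRM ?powR_ge0// -powRrM.
  have -> : (2^-1 : R) `^ q = 2 `^ (- q).
    by rewrite -powR_inv1// -powRrM mulN1r.
  by rewrite [p^-1 * q]mulrC; ring.
have : (\int[lebesgue_measure]_(t in `]0%R, +oo[) (Psi t)%:E <= C0%:E * I)%E.
  rewrite -ge0_integralZl_EFin ?(ltW C00)//; last 2 first.
  - move=> t; rewrite /= in_itv/= andbT => t0.
    by rewrite mule_ge0 ?poweR_ge0// lee_fin invr_ge0 ltW.
  - exact: measurable_lorentz_integrand.
  apply: ge0_le_integral => //.
  - move=> t _; rewrite lee_fin sumr_ge0// => a _; rewrite sumr_ge0// => b _.
    by rewrite mulr_ge0.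
  - by apply/measurable_EFinP; do 2 (apply: measurable_sum => ?); exact: mc.
  - apply: measurable_funeM; exact: measurable_lorentz_integrand.
  - by move=> t; rewrite /= in_itv/= andbT => t0; exact: ptw.
move=> /le_trans/(_ (lee_wpmul2l _ IVq)); rewrite lee_fin => /(_ (ltW C00)).
rewrite IPsi -EFinM lee_fin powRN mulrC ler_pdivrMr ?powR_gt0// => H.
apply: le_trans H _; rewrite [in leRHS]powRM ?mulr_ge0 ?powR_ge0//.
rewrite [in leRHS]powRM ?powR_ge0// -powRrM mulVf ?gt_eqF// powRr1 ?(ltW C00)//.
by rewrite le_eqVlt; apply/orP; left; apply/eqP; ring.
Qed.

Lemma dist_fun_sup_normE h : (forall x, 0 <= h x) ->
  lorentz_norm (X := X) p +oo (EFin \o h) =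
  ereal_sup [set (t%:E * level_mass h t `^ p^-1)%E | t in `]0%R, +oo[].
Proof.
by move=> h0; congr ereal_sup; apply: eq_imagel => t _; rewrite dist_funE.
Qed.

Lemma lorentz_norm_le h (q : \bar R) (S : R) : (1 <= q)%E -> 0 <= S ->
  (forall x, 0 <= h x) -> lq_bounded q (profile h) S ->
  (lorentz_norm (X := X) p q (EFin \o h) <= (4 * p * S)%:E)%E.
Proof.
case: q => [q|_|//]; first by rewrite lee_fin; exact: lorentz_norm_le_fin.
move=> S0 h0 xS; rewrite dist_fun_sup_normE//.
have p0 : 0 < p := lt_trans ltr01 p1.
apply: ge_ereal_sup => _ [t /= + <-]; rewrite in_itv/= andbT => t0.
pose B := 4 * (S / t) `^ p.
have B0 : 0 <= B by rewrite mulr_ge0// powR_ge0.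
have St0 : 0 <= S / t by rewrite divr_ge0// ltW.
have lB : (level_mass h t <= B%:E)%E.
  apply: level_mass_le => // a b be tb; rewrite ler_pM2l//.
  have := xS _ _ be; rewrite /profile.
  move: (block_mass T a b) (block_mass_gt0 T a b) => M M0 MS.
  have -> : M = (M `^ p^-1) `^ p by rewrite -powRrM mulVf ?gt_eqF// powRr1// ltW.
  apply: ge0_ler_powR; rewrite ?nnegrE ?powR_ge0 ?(ltW p0)//.
  rewrite ler_pdivlMr//; apply: le_trans MS.
  by rewrite ler_wpM2l ?powR_ge0.
apply: (@le_trans _ _ (t%:E * B%:E `^ p^-1)%E).
  apply: lee_wpmul2l; first by rewrite lee_fin ltW.
  by apply: lee_poweR => //; [rewrite invr_ge0 ltW|exact: level_mass_ge0].
rewrite poweR_EFin -EFinM lee_fin /B powRM ?powR_ge0// -powRrM.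
rewrite divff ?gt_eqF// powRr1// mulrCA [t * _]mulrC divfK ?gt_eqF//.
rewrite ler_wpM2r//; apply: (@le_trans _ _ 4).
  rewrite -[leRHS]powRr1//; apply: ler_powR; first by rewrite ler1n.
  by rewrite invf_le1// ltW.
by rewrite ler_peMr// ltW.
Qed.

Lemma lorentz_norm_ge (q : \bar R) : (1 <= q)%E -> exists2 C : R, 0 <= C &
  forall h V, (forall x, 0 <= h x) -> 0 <= V ->
  (lorentz_norm (X := X) p q (EFin \o h) <= V%:E)%E ->
  lq_bounded q (profile h) (C * V).
Proof.
case: q => [q|_|//]; first by rewrite lee_fin; exact: lorentz_norm_ge_fin.
exists 1 => // h V h0 V0; rewrite dist_fun_sup_normE// mul1r => hV a b be.
have p0 : 0 < p := lt_trans ltr01 p1.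
have : 0 <= star h a b by exact: star_ge0.
rewrite /profile le_eqVlt => /predU1P[<-|s0]; first by rewrite mulr0.
rewrite -lee_fin; apply: le_trans hV; apply: le_ereal_sup_tmp.
exists ((star h a b)%:E * level_mass h (star h a b) `^ p^-1)%E.
  by exists (star h a b) => //=; rewrite in_itv/= s0.
rewrite mulrC EFinM lee_wpmul2l ?lee_fin ?(ltW s0)//.
rewrite -poweR_EFin lee_poweR ?invr_ge0 ?(ltW p0)//.
  by rewrite lee_fin ltW// block_mass_gt0.
exact: level_mass_ge.
Qed.

End lorentz_discretization.

(** * Boundedness of the maximal operator *)

Lemma sum_pred_inj_le (B M : nat) (P : pred nat) (F : nat -> nat) :
  (forall k, (k < B)%N -> P k -> (F k < M)%N) ->
  (forall k l, (k < B)%N -> (l < B)%N -> P k -> P l -> F k = F l -> k = l) ->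
  (\sum_(k < B) P k <= M)%N.
Proof.
move=> FM Finj; rewrite -(big_mkord xpredT (fun k => P k : nat)) /index_iota subn0.
rewrite (eq_bigr (fun k => if P k then 1%N else 0%N)); last by move=> k _; case: (P k).
rewrite -big_mkcond sum1_count -size_filter -(size_map F) -[leqRHS](size_iota 0).
apply: uniq_leq_size.
  rewrite map_inj_in_uniq ?filter_uniq ?iota_uniq// => k l.
  rewrite !mem_filter !mem_iota !add0n => /andP[Pk kB] /andP[Pl lB].
  exact: Finj.
move=> _ /mapP[k + ->]; rewrite mem_filter !mem_iota !add0n => /andP[Pk kB].
by rewrite FM.
Qed.

(** * Rearrangement under reduction modulo a power of two *)

Section rank_classes.
Context (R : realType) (g : nat -> R) (E : nat).
Local Notation n := (2 ^ E)%N.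
Local Notation rk := (ranking g n).

(** The rank of [x] in the decreasing order; [cls] below is its dyadic class, shifted by one because
    ranks start at 0. *)
Let pos x := index x rk.
Let cls x := trunc_log 2 (pos x).+1.

Let pos_lt x : (x < n)%N -> (pos x < n)%N.
Proof.
by move=> xn; rewrite -[X in (_ < X)%N](size_ranking g) index_mem
  (perm_mem (perm_ranking _ _)) mem_iota.
Qed.

Let nth_pos x : (x < n)%N -> nth 0%N rk (pos x) = x.
Proof. by move=> xn; rewrite nth_index// -index_mem size_ranking pos_lt. Qed.

Let cls_bounds x : (2 ^ cls x <= (pos x).+1 < 2 ^ (cls x).+1)%N.
Proof. exact: trunc_log_bounds. Qed.

Let cls_le x : (x < n)%N -> (cls x < E.+1)%N.
Proof.
move=> xn; rewrite ltnS -(@leq_exp2l 2)//.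
by case/andP: (cls_bounds x) => /leq_trans + _; apply; exact: pos_lt.
Qed.

Let le_ranked_cls x : (x < n)%N -> g x <= ranked g n (2 ^ cls x).-1.
Proof.
move=> xn; rewrite -{1}(nth_pos xn); apply: ranked_noninc.
rewrite pos_lt// andbT; case/andP: (cls_bounds x) => + _.
by rewrite -[X in (X <= _)%N -> _]prednK ?expn_gt0.
Qed.

(** Values of class [c] are at most [ranked g n (2 ^ c).-1]. The class has at most [2 ^ c] residues
    and each residue has [2 ^ (E' - E)] representatives below [2 ^ E'], which bounds how often the
    class is visited. *)
Lemma sum_mod_ranked (B E' : nat) (r : nat -> nat) : (E <= E')%N ->
  (forall x, 0 <= g x) ->
  (forall k, (k < B)%N -> (r k < 2 ^ E')%N) ->
  (forall k l, (k < B)%N -> (l < B)%N -> r k = r l -> k = l) ->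
  \sum_(k < B) g (r k %% n)%N <=
  \sum_(c < E.+1) ranked g n (2 ^ c).-1 * (minn B (2 ^ (c + (E' - E))))%:R.
Proof.
move=> EE g0 rE rinj.
have rn k : (r k %% n < n)%N by rewrite ltn_mod expn_gt0.
apply: (@le_trans _ _ (\sum_(k < B) \sum_(c < E.+1)
    ranked g n (2 ^ c).-1 * (cls (r k %% n) == c)%N%:R)).
  apply: ler_sum => k _; rewrite (bigD1 (Ordinal (cls_le (rn k))))//= eqxx mulr1.
  rewrite -[leLHS]addr0 lerD// ?le_ranked_cls// sumr_ge0// => c _.
  by rewrite mulr_ge0//; exact: g0.
rewrite exchange_big/=; apply: ler_sum => c _; rewrite -mulr_sumr.
apply: ler_wpM2l; first exact: g0.
rewrite -natr_sum ler_nat leq_min; apply/andP; split.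
  rewrite -[leqRHS]card_ord -sum1_card; apply: leq_sum => i _; exact: leq_b1.
(* Visits to class [c] are encoded injectively by the quotient of [r k] and the offset of the
   residue inside the class, written as digits in base [2 ^ c]. *)
apply: (@sum_pred_inj_le _ _ (fun k => cls (r k %% n) == c)%N
  (fun k => (r k %/ n) * 2 ^ c + (pos (r k %% n) - (2 ^ c).-1))%N).
  move=> k kB /eqP kc; have := cls_bounds (r k %% n)%N; rewrite kc => /andP[lo up].
  rewrite expnD mulnC.
  have : (r k %/ n < 2 ^ (E' - E))%N.
    by rewrite ltn_divLR ?expn_gt0// -expnD subnK// rE.
  have : (0 < 2 ^ c)%N by rewrite expn_gt0.
  move: up; rewrite expnS; nia.
move=> k l kB lB /eqP kc /eqP lc H; apply: rinj => //.
have := cls_bounds (r k %% n)%N; have := cls_bounds (r l %% n)%N.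
rewrite kc lc expnS => /andP[lo up] /andP[lo' up'].
have c0 : (0 < 2 ^ c)%N by rewrite expn_gt0.
have [dE pE] : (r k %/ n = r l %/ n /\ pos (r k %% n) = pos (r l %% n))%N.
  move: H lo up lo' up' c0; move: (pos _) (pos _) (2 ^ c)%N (_ %/ _)%N (_ %/ _)%N.
  move=> x y C u v H *; suff uv : u = v by subst u; split=> //; lia.
  nia.
by rewrite (divn_eq (r k) n) (divn_eq (r l) n) dE -(nth_pos (rn k)) pE nth_pos.
Qed.

End rank_classes.

(** * Geometric kernels *)

Section kernel.
Context (R : realType) (lam : R).
Hypothesis lam01 : 0 <= lam < 1.

(** The distance between [u] and [v]: one of the truncated differences vanishes. *)
Definition gap (u v : nat) : nat := ((u - v) + (v - u))%N.

Lemma gapC u v : gap u v = gap v u.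
Proof. exact: addnC. Qed.

(** The sum splits at [v] into two geometric series; [A] and [B] below bound their partial sums by
    closed forms adapted to induction. *)
Lemma sum_kernel_le u v n :
  \sum_(k < n) lam ^+ gap (u + k) v <= 2 / (1 - lam).
Proof.
case/andP: lam01 => l0 l1; have d0 : 0 < 1 - lam by rewrite subr_gt0.
have A k : \sum_(i < k) (if (v <= u + i)%N then lam ^+ (u + i - v) else 0) <=
    (1 - lam ^+ (u + k - v)) / (1 - lam).
  elim: k => [|k IH].
    by rewrite big_ord0 divr_ge0 ?(ltW d0)// subr_ge0 exprn_ile1// ltW.
  rewrite big_ord_recr/=; case: ifPn => uv.
    apply: (le_trans (lerD IH (lexx _))).
    have -> : (u + k.+1 - v = (u + k - v).+1)%N by lia.
    rewrite exprS le_eqVlt; apply/orP; left; apply/eqP; field; exact: lt0r_neq0.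
  rewrite addr0; apply: le_trans IH _.
  have -> : (u + k - v = 0)%N by lia.
  have -> : (u + k.+1 - v = 0)%N by lia.
  by [].
have B k : \sum_(i < k) (if (v <= u + i)%N then 0 else lam ^+ (v - (u + i))) <=
    lam ^+ (v - (u + k)) * lam / (1 - lam).
  elim: k => [|k IH].
    by rewrite big_ord0 divr_ge0 ?(ltW d0)// mulr_ge0// exprn_ge0.
  rewrite big_ord_recr/=; case: ifPn => uv.
    rewrite addr0; apply: le_trans IH _.
    have -> : (v - (u + k) = 0)%N by lia.
    have -> : (v - (u + k.+1) = 0)%N by lia.
    by [].
  apply: (le_trans (lerD IH (lexx _))).
  have -> : (v - (u + k) = (v - (u + k.+1)).+1)%N by lia.
  rewrite exprS le_eqVlt; apply/orP; left; apply/eqP; field; exact: lt0r_neq0.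
rewrite (eq_bigr (fun i : 'I_n => (if (v <= u + i)%N then lam ^+ (u + i - v) else 0) +
  (if (v <= u + i)%N then 0 else lam ^+ (v - (u + i))))); last first.
  move=> i _; rewrite /gap; case: ifPn => uv; rewrite ?addr0 ?add0r.
    have -> : (v - (u + i) = 0)%N by lia.
    by rewrite addn0.
  have -> : (u + i - v = 0)%N by lia.
  by rewrite add0n.
rewrite big_split/=; apply: (le_trans (lerD (A n) (B n))).
rewrite -mulrDl ler_pM2r ?invr_gt0//.
have := exprn_ge0 (u + n - v) l0; have := exprn_ge0 (v - (u + n)) l0.
have : lam ^+ (v - (u + n)) * lam <= 1.
  by rewrite -exprSr exprn_ile1// ltW.
lra.
Qed.

End kernel.

(* Jensen's inequality up to the factor [2]: [x <= t + x `^ q * t `^ (1 - q)],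
   with [t] chosen so that both terms contribute equally. *)
Lemma weighted_sum_le (R : realType) (I : finType) (P : pred I) (w x : I -> R) (q W : R) :
  1 <= q -> (forall i, 0 <= w i) -> (forall i, 0 <= x i) ->
  0 < W -> \sum_(i | P i) w i <= W ->
  (\sum_(i | P i) w i * x i) `^ q <=
  2 `^ q * W `^ (q - 1) * \sum_(i | P i) w i * x i `^ q.
Proof.
move=> q1 w0 x0 W0 wW; have q0 : 0 < q := lt_le_trans ltr01 q1.
set S := \sum_(i | P i) w i * x i `^ q.
have S0 : 0 <= S by apply: sumr_ge0 => i _; rewrite mulr_ge0// powR_ge0.
have T0 : 0 <= \sum_(i | P i) w i * x i by apply: sumr_ge0 => i _; rewrite mulr_ge0.
have [S00|Spos] := eqVneq S 0.
  rewrite S00 mulr0 big1 ?powR0 ?gt_eqF// => i Pi; apply/eqP.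
  have wx0 j : P j -> 0 <= w j * x j `^ q by rewrite mulr_ge0// powR_ge0.
  have /eqP := psumr_eq0P wx0 S00 Pi.
  rewrite mulf_eq0 powR_eq0 => /orP[/eqP->|/andP[/eqP-> _]].
    by rewrite mul0r.
  by rewrite mulr0.
have {Spos}S0' : 0 < S by rewrite lt_neqAle eq_sym Spos.
have [t t0 tq] : exists2 t, 0 < t & t `^ q = S / W.
  exists ((S / W) `^ q^-1); first by rewrite powR_gt0// divr_gt0.
  by rewrite -powRrM mulVf ?gt_eqF// powRr1// ltW// divr_gt0.
have H : \sum_(i | P i) w i * x i <= 2 * (t * W).
  apply: (@le_trans _ _ (\sum_(i | P i) (w i * t + w i * x i `^ q * t `^ (1 - q)))).
    apply: ler_sum => i _; rewrite -mulrA -mulrDr ler_wpM2l//.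
    have [xt|tx] := leP (x i) t.
      by rewrite (le_trans xt)// lerDl mulr_ge0// powR_ge0.
    have xi0 : 0 < x i := lt_trans t0 tx.
    apply: (@le_trans _ _ (x i `^ q * t `^ (1 - q))); last by rewrite lerDr ltW.
    have -> : t `^ (1 - q) = (t `^ (q - 1))^-1 by rewrite -powRN opprB.
    rewrite ler_pdivlMr ?powR_gt0// -[x i `^ q]mulr_powRB1// ?(ltW xi0)//.
    rewrite ler_pM2l//; apply: ge0_ler_powR; rewrite ?nnegrE ?subr_ge0 ?(ltW t0)// ltW//.
  rewrite big_split/= -!mulr_suml -/S.
  have -> : S * t `^ (1 - q) = t * W.
    have -> : t `^ (1 - q) = t / t `^ q.
      by rewrite powRB ?powRr1 ?(ltW t0)//; apply/implyP => _; rewrite gt_eqF.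
    by rewrite tq; field; rewrite !gt_eqF.
  have : (\sum_(i | P i) w i) * t <= W * t by rewrite ler_pM2r.
  lra.
apply: (@le_trans _ _ ((2 * (t * W)) `^ q)).
  apply: ge0_ler_powR; rewrite ?nnegrE// ?(ltW q0)// mulr_ge0// mulr_ge0// ltW//.
rewrite !powRM ?mulr_ge0 ?(ltW t0) ?(ltW W0)// tq.
rewrite -[W `^ q]mulr_powRB1 ?(ltW W0)// le_eqVlt; apply/orP; left; apply/eqP.
by field; rewrite gt_eqF.
Qed.

(** * The operator [spread] in profile coordinates *)

Section spread_profile.
Context (R : realType) (T : layout R) (p : R) (kap : nat -> R).
Local Notation e := (lexp T).
Local Notation m a := (lmass T a)%:num.
Hypothesis p1 : 1 < p.

(** The kernel decays with exponent [1 - p^-1] on one side of the diagonal and [p^-1] on the other;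
    this is the slower of the two rates. *)
Definition decay : R := 2 `^ (- Num.min p^-1 (1 - p^-1)).

Lemma decay01 : 0 <= decay < 1.
Proof.
rewrite powR_ge0/=; apply: powR2N_lt1; rewrite lt_min invr_gt0 subr_gt0.
by rewrite (lt_trans ltr01 p1) invf_lt1 ?(lt_trans ltr01 p1).
Qed.

(** The relation between masses under which the passage from tier [i] to tier [a] is [k] times a
    kernel governed only by the difference of [e i + b] and [e a + c]. *)
Definition scaled (k : R) (i a : nat) :=
  m i `^ (1 - p^-1) = k * 2 `^ (((e i)%:R - (e a)%:R) / p) * m a `^ (1 - p^-1).

Lemma kernel_term (k : R) i a b c : 0 <= k -> scaled k i a -> (e i <= e a)%N ->
  block_mass T a b `^ p^-1 * (2 ^+ b)^-1 * (m i / m a) *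
    (minn (2 ^ b) (2 ^ (c + (e a - e i))))%:R <=
  k * decay ^+ gap (e i + b) (e a + c) * block_mass T i c `^ p^-1.
Proof.
move=> k0 sc ie; have p0 : 0 < p := lt_trans ltr01 p1.
have pw n : 2 ^+ n = 2 `^ n%:R :> R by rewrite powR_mulrn.
have mE j : m j = m j `^ p^-1 * m j `^ (1 - p^-1).
  rewrite -powRD; first by rewrite addrC subrK powRr1.
  by rewrite addrC subrK oner_eq0.
rewrite /block_mass ![(m _ * 2 ^+ _) `^ _]powRM//.
have -> : m i / m a = m i `^ p^-1 * m i `^ (1 - p^-1) /
    (m a `^ p^-1 * m a `^ (1 - p^-1)) by rewrite -!mE.
rewrite sc.
set x := m a `^ p^-1; set y := m a `^ (1 - p^-1); set z := m i `^ p^-1.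
have x0 : 0 < x by exact: powR_gt0.
have y0 : 0 < y by exact: powR_gt0.
have z0 : 0 < z by exact: powR_gt0.
set mn := (minn _ _)%:R.
suff H : (2 ^+ b) `^ p^-1 * (2 ^+ b)^-1 * 2 `^ (((e i)%:R - (e a)%:R) / p) * mn <=
    decay ^+ gap (e i + b) (e a + c) * (2 ^+ c) `^ p^-1.
  have -> : x * (2 ^+ b) `^ p^-1 / 2 ^+ b *
    (z * (k * 2 `^ (((e i)%:R - (e a)%:R) / p) * y) / (x * y)) * mn =
    (k * z) * ((2 ^+ b) `^ p^-1 * (2 ^+ b)^-1 *
       2 `^ (((e i)%:R - (e a)%:R) / p) * mn).
    have : 2 ^+ b != 0 :> R by rewrite expf_neq0.
    move: (2 ^+ b) ((2 ^+ b) `^ _) (2 `^ _) => w v u w0.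
    by field; rewrite w0 !gt_eqF.
  have -> : k * decay ^+ gap (e i + b) (e a + c) * (z * (2 ^+ c) `^ p^-1) =
    (k * z) * (decay ^+ gap (e i + b) (e a + c) * (2 ^+ c) `^ p^-1).
    by rewrite -!mulrA; congr (_ * _); rewrite mulrCA.
  by apply: ler_wpM2l => //; rewrite mulr_ge0// ltW.
have -> : (2 ^+ b) `^ p^-1 = 2 `^ (b%:R / p) :> R by rewrite pw powRrM.
have -> : (2 ^+ c) `^ p^-1 = 2 `^ (c%:R / p) :> R by rewrite pw powRrM.
have -> : (2 ^+ b)^-1 = 2 `^ (- b%:R) :> R by rewrite pw powRN.
have -> : decay ^+ gap (e i + b) (e a + c) =
    2 `^ (- Num.min p^-1 (1 - p^-1) * (gap (e i + b) (e a + c))%:R).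
  by rewrite -powR_mulrn ?powR_ge0// powRrM.
have pD u v : 2 `^ u * 2 `^ v = 2 `^ (u + v) :> R.
  by rewrite powRD// pnatr_eq0 implybT.
have e1 : Num.min p^-1 (1 - p^-1) <= p^-1 by rewrite ge_min lexx.
have e2 : Num.min p^-1 (1 - p^-1) <= 1 - p^-1 by rewrite ge_min lexx orbT.
move: (Num.min _ _) e1 e2 => ep e1 e2; rewrite !pD.
have l12 : 1 <= 2 :> R by rewrite ler1n.
(* The second entry of the minimum is used when [e a + c <= e i + b] and yields the rate [1 - p^-1];
   the first entry yields the rate [p^-1] otherwise. *)
have [le|lt] := leqP (e a + c) (e i + b).
  apply: (@le_trans _ _ (2 `^ (b%:R / p + - b%:R + ((e i)%:R - (e a)%:R) / p) *
     2 `^ (c%:R + ((e a)%:R - (e i)%:R)))).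
    rewrite ler_wpM2l ?powR_ge0// -natrB// -natrD powR_mulrn// -natrX ler_nat.
    exact: geq_minr.
  rewrite pD; apply: ler_powR => //.
  have -> : (gap (e i + b) (e a + c))%:R = (e i)%:R + b%:R - (e a)%:R - c%:R :> R.
    rewrite /gap (_ : (e a + c - (e i + b) = 0)%N); last by lia.
    by rewrite addn0 natrB// !natrD; ring.
  set g := (X in - ep * X).
  have g0 : 0 <= g by move: le; rewrite -(ler_nat R) !natrD /g; lra.
  have -> : b%:R / p + - b%:R + ((e i)%:R - (e a)%:R) / p + (c%:R + ((e a)%:R - (e i)%:R))
    = - (1 - p^-1) * g + c%:R / p :> R by rewrite /g; ring.
  by rewrite lerD2r !mulNr lerN2 ler_wpM2r.
apply: (@le_trans _ _ (2 `^ (b%:R / p + - b%:R + ((e i)%:R - (e a)%:R) / p) *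
     2 `^ b%:R)).
  by rewrite ler_wpM2l ?powR_ge0// powR_mulrn// -natrX ler_nat geq_minl.
rewrite pD; apply: ler_powR => //.
have -> : (gap (e i + b) (e a + c))%:R = (e a)%:R + c%:R - (e i)%:R - b%:R :> R.
  rewrite /gap (_ : (e i + b - (e a + c) = 0)%N); last by lia.
  by rewrite add0n natrB; [rewrite !natrD; ring|exact: ltnW lt].
set g := (X in - ep * X).
have g0 : 0 <= g by have := ltnW lt; rewrite -(ler_nat R) !natrD /g; lra.
have -> : b%:R / p + - b%:R + ((e i)%:R - (e a)%:R) / p + b%:R
  = - p^-1 * g + c%:R / p :> R by rewrite /g; ring.
by rewrite lerD2r !mulNr lerN2 ler_wpM2r.
Qed.

Hypothesis center_lt : forall a c, center_of T a c -> (c < a)%N /\ (e c <= e a)%N.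
Hypothesis kap_ge0 : forall a, 0 <= kap a.
Hypothesis center_scaled : forall a c, center_of T a c -> scaled (kap a) c a.

(** The [2 ^ b]-th largest value is at most the mean over the [2 ^ b] top points of the tier. Their
    links hit each center tier through reduction modulo its size, so [sum_mod_ranked] and
    [kernel_term] apply tier by tier. *)
Lemma profile_spread_le (f : carrier T -> R) a b : (forall x, 0 <= f x) ->
  (b <= e a)%N ->
  profile p (spread f) a b <=
  \sum_(c < (e a).+1) decay ^+ gap (e a + b) (e a + c) * profile p f a c +
  kap a * \sum_(i < a | center_of T a i) \sum_(c < (e i).+1)
     decay ^+ gap (e i + b) (e a + c) * profile p f i c.
Proof.
move=> f0 be; rewrite {1}/profile.
set h := spread f; set rk := ranking (fun k => h (a, k)) (2 ^ e a).
have b2 : (2 ^ b <= 2 ^ e a)%N by rewrite leq_exp2l.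
have rlt k : (k < 2 ^ b)%N -> (nth 0%N rk k < 2 ^ e a)%N.
  move=> kb; have : nth 0%N rk k \in rk.
    by apply: mem_nth; rewrite size_ranking (leq_trans kb).
  by rewrite (perm_mem (perm_ranking _ _)) mem_iota.
have rinj k l : (k < 2 ^ b)%N -> (l < 2 ^ b)%N -> nth 0%N rk k = nth 0%N rk l -> k = l.
  move=> kb lb /eqP; rewrite nth_uniq ?size_ranking ?(leq_trans kb) ?(leq_trans lb)//.
    by move/eqP.
  by rewrite sort_uniq iota_uniq.
have term i : (e i <= e a)%N ->
    \sum_(k < 2 ^ b) f (i, nth 0 rk k %% 2 ^ e i)%N <=
    \sum_(c < (e i).+1) star f i c * (minn (2 ^ b) (2 ^ (c + (e a - e i))))%:R.
  by move=> ie; apply: (sum_mod_ranked ie _ rlt rinj).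
have starh : star h a b <= (2 ^+ b)^-1 * \sum_(k < 2 ^ b) h (a, nth 0%N rk k).
  rewrite mulrC ler_pdivlMr ?exprn_gt0//.
  have -> : star h a b * 2 ^+ b = \sum_(k < 2 ^ b) star h a b.
    by rewrite sumr_const card_ord -[RHS]mulr_natr natrX.
  apply: ler_sum => k _; apply: ranked_noninc.
  by have := ltn_ord k; have := expn_gt0 2 b; lia.
have hE : \sum_(k < 2 ^ b) h (a, nth 0%N rk k) =
    \sum_(k < 2 ^ b) f (a, nth 0 rk k %% 2 ^ e a)%N +
    \sum_(i < a | center_of T a i) m i / m a *
      \sum_(k < 2 ^ b) f (i : nat, nth 0 rk k %% 2 ^ e i)%N.
  rewrite /h /spread big_split/=; congr (_ + _).
    by apply: eq_bigr => k _; rewrite modn_small// rlt.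
  by rewrite exchange_big/=; apply: eq_bigr => i _; rewrite mulr_sumr.
have P0 : 0 <= block_mass T a b `^ p^-1 * (2 ^+ b)^-1.
  by rewrite mulr_ge0 ?powR_ge0// invr_ge0 exprn_ge0.
have bound i k : 0 <= k -> scaled k i a -> (e i <= e a)%N ->
    block_mass T a b `^ p^-1 * (2 ^+ b)^-1 *
      (m i / m a * \sum_(k < 2 ^ b) f (i, nth 0 rk k %% 2 ^ e i)%N) <=
    k * \sum_(c < (e i).+1) decay ^+ gap (e i + b) (e a + c) * profile p f i c.
  move=> k0 sc ie; rewrite mulrA.
  apply: (le_trans (ler_wpM2l _ (term _ ie))).
    by rewrite mulr_ge0// divr_ge0.
  rewrite !mulr_sumr; apply: ler_sum => c _.
  have := kernel_term b c k0 sc ie => /(ler_wpM2l (star_ge0 i c f0)).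
  rewrite /profile => H; apply: le_trans (le_trans H _); rewrite le_eqVlt;
    by apply/orP; left; apply/eqP; ring.
apply: (le_trans (ler_wpM2l (powR_ge0 _ _) starh)).
rewrite mulrA hE mulrDr lerD//.
  (* The summand [f x] of [spread] is the case [i = a], [k = 1], where [scaled] is trivial. *)
  have := bound a 1 ler01; rewrite divff ?gt_eqF// !mul1r; apply=> //.
  by rewrite /scaled subrr mul0r powRr0 !mul1r.
rewrite !mulr_sumr; apply: ler_sum => i ca.
by apply: bound; [exact: kap_ge0|exact: center_scaled|case: (center_lt ca)].
Qed.

End spread_profile.

Lemma recip_fin (R : realType) (q : R) : 1 <= q -> recip q%:E = q^-1.
Proof. by move=> q1; rewrite /recip inver gt_eqF// (lt_le_trans ltr01). Qed.

Lemma recip_pinfty (R : realType) : recip +oo%E = 0 :> R.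
Proof. by rewrite /recip invey. Qed.

Lemma sum_powR_le (R : realType) (I : finType) (y : I -> R) (q r : R) :
  0 < q -> q <= r -> (forall i, 0 <= y i) ->
  \sum_i y i `^ r <= (\sum_i y i `^ q) `^ (r / q).
Proof.
move=> q0 qr y0; have r0 : 0 < r := lt_le_trans q0 qr.
set Y := \sum_i y i `^ q.
have yY i : y i `^ q <= Y.
  by rewrite /Y (bigD1 i)//= lerDl sumr_ge0// => j _; exact: powR_ge0.
have Y0 : 0 <= Y by apply: sumr_ge0 => j _; exact: powR_ge0.
have rq1 : 0 <= r / q - 1 by rewrite subr_ge0 ler_pdivlMr// mul1r.
rewrite -[leRHS]mulr_powRB1 ?divr_gt0// mulr_suml; apply: ler_sum => i _.
have -> : y i `^ r = y i `^ q * (y i `^ q) `^ (r / q - 1).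
  rewrite mulr_powRB1 ?powR_ge0 ?divr_gt0// -powRrM; congr (_ `^ _).
  by field; rewrite gt_eqF.
rewrite ler_wpM2l ?powR_ge0//; apply: ge0_ler_powR; rewrite ?nnegrE ?powR_ge0//.
Qed.

Lemma powR_ratio_le (R : realType) (y S q r : R) : 0 < q -> q <= r ->
  0 <= S -> 0 <= y <= S `^ q -> y `^ (r / q) <= y * S `^ (r - q).
Proof.
move=> q0 qr S0 /andP[y0 yS]; have r0 : 0 < r := lt_le_trans q0 qr.
have rq1 : 0 <= r / q - 1 by rewrite subr_ge0 ler_pdivlMr// mul1r.
rewrite -[leLHS]mulr_powRB1 ?divr_gt0// ler_wpM2l//.
have -> : S `^ (r - q) = (S `^ q) `^ (r / q - 1).
  by rewrite -powRrM; congr (_ `^ _); field; rewrite gt_eqF.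
by apply: ge0_ler_powR; rewrite ?nnegrE ?powR_ge0.
Qed.

Lemma powRD_le (R : realType) (u w r : R) : 0 < r -> 0 <= u -> 0 <= w ->
  (u + w) `^ r <= 2 `^ r * (u `^ r + w `^ r).
Proof.
move=> r0 u0 w0; apply: (@le_trans _ _ ((2 * Num.max u w) `^ r)).
  apply: ge0_ler_powR; rewrite ?nnegrE ?(ltW r0) ?addr_ge0 ?mulr_ge0 ?le_max ?u0//.
  have : u <= Num.max u w by rewrite le_max lexx.
  have : w <= Num.max u w by rewrite le_max lexx orbT.
  lra.
rewrite powRM ?le_max ?u0// ler_wpM2l ?powR_ge0//.
by case: (leP u w) => _; rewrite ?lerDl ?lerDr powR_ge0.
Qed.

Lemma addr_powR_le (R : realType) (x y r : R) : 1 <= r -> 0 <= x -> 0 <= y ->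
  x `^ r + y `^ r <= (2 * (x + y)) `^ r.
Proof.
move=> r1 x0 y0; have r0 : 0 < r := lt_le_trans ltr01 r1.
rewrite powRM ?addr_ge0//.
have xr : x `^ r <= (x + y) `^ r.
  by apply: ge0_ler_powR; rewrite ?nnegrE ?(ltW r0) ?addr_ge0// lerDl.
have yr : y `^ r <= (x + y) `^ r.
  by apply: ge0_ler_powR; rewrite ?nnegrE ?(ltW r0) ?addr_ge0// lerDr.
have : 2 <= 2 `^ r :> R by apply: le1r_powR => //; rewrite ler1n.
have := powR_ge0 (x + y) r => z0 h2.
have : 2 * (x + y) `^ r <= 2 `^ r * (x + y) `^ r by rewrite ler_wpM2r.
lra.
Qed.

(** * Bounds for [spread] from l^q to l^r *)

Section spread_bounded.
Context (R : realType) (T : layout R) (p : R) (kap Nc Lc : nat -> R).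
Local Notation e := (lexp T).
Local Notation m a := (lmass T a)%:num.
Hypothesis p1 : 1 < p.
Hypothesis center_lt : forall a c, center_of T a c -> (c < a)%N /\ (e c <= e a)%N.
Hypothesis kap_ge0 : forall a, 0 <= kap a.
Hypothesis center_scaled : forall a c, center_of T a c -> scaled T p (kap a) c a.
Hypothesis Nc_ge1 : forall a, 1 <= Nc a.
Hypothesis Lc_ge1 : forall a, 1 <= Lc a.
Hypothesis card_centers : forall a, \sum_(i < a | center_of T a i) 1 <= Nc a.
Hypothesis card_leaves : forall i A, \sum_(a < A | center_of T a i) (Lc a)^-1 <= 1.

(** A common bound for the row and column sums of the kernel, as in Schur's test. *)
Let W0 : R := locked (2 / (1 - decay p)).

Let W0_gt0 : 0 < W0.
Proof. by rewrite /W0 -lock divr_gt0// subr_gt0; case/andP: (decay01 p1). Qed.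

Let kerc i c a : \sum_(b < (e a).+1) decay p ^+ gap (e i + b) (e a + c) <= W0.
Proof. rewrite /W0 -lock; exact: sum_kernel_le (decay01 p1) _ _ _. Qed.

Let kerb i b a : \sum_(c < (e i).+1) decay p ^+ gap (e i + b) (e a + c) <= W0.
Proof.
rewrite /W0 -lock; under eq_bigr do rewrite gapC.
exact: sum_kernel_le (decay01 p1) _ _ _.
Qed.

Let ker_ge0 u v : 0 <= decay p ^+ gap u v.
Proof. by rewrite exprn_ge0//; case/andP: (decay01 p1). Qed.

Section fixed_function.
Variables (f : carrier T -> R) (q : R).
Hypothesis f_ge0 : forall x, 0 <= f x.
Hypothesis q1 : 1 <= q.
Let q0 : 0 < q. Proof. exact: lt_le_trans ltr01 q1. Qed.

Let x := profile p f.
Let x_ge0 i c : 0 <= x i c.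
Proof. by rewrite mulr_ge0 ?powR_ge0//; exact: star_ge0. Qed.

Definition transfer i a b := \sum_(c < (e i).+1) decay p ^+ gap (e i + b) (e a + c) * x i c.
Definition tier_energy i := \sum_(c < (e i).+1) x i c `^ q.
Definition centers_energy a := \sum_(i < a | center_of T a i) tier_energy i.

Lemma transfer_ge0 i a b : 0 <= transfer i a b.
Proof. by apply: sumr_ge0 => c _; rewrite mulr_ge0. Qed.

Lemma tier_energy_ge0 i : 0 <= tier_energy i.
Proof. by apply: sumr_ge0 => c _; exact: powR_ge0. Qed.

(** Schur's test: [weighted_sum_le] with the row sums as weights, then the column sums after
    exchanging the two summations. *)
Lemma sum_transfer_le i a :
  \sum_(b < (e a).+1) transfer i a b `^ q <= (2 * W0) `^ q * tier_energy i.
Proof.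
apply: (@le_trans _ _ (\sum_(b < (e a).+1) 2 `^ q * W0 `^ (q - 1) *
    \sum_(c < (e i).+1) decay p ^+ gap (e i + b) (e a + c) * x i c `^ q)).
  apply: ler_sum => b _.
  by apply: (weighted_sum_le (P := xpredT)) => //; exact: kerb.
rewrite -mulr_sumr exchange_big/= powRM ?(ltW W0_gt0)//.
rewrite -[W0 `^ q]mulr_powRB1 ?(ltW W0_gt0)// [W0 * _]mulrC mulrA -[leRHS]mulrA.
rewrite ler_wpM2l ?mulr_ge0 ?powR_ge0// mulr_sumr; apply: ler_sum => c _.
by rewrite -mulr_suml ler_wpM2r ?powR_ge0 ?kerc.
Qed.

(** Jensen's inequality over at most [Nc a] center tiers costs [Nc a]^ (q - 1)[, that is]Nc a
    [^ (1 - q^-1)] after taking the root. *)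
Lemma sum_centers_transfer_le a :
  \sum_(b < (e a).+1) (kap a * \sum_(i < a | center_of T a i) transfer i a b) `^ q
  <= (4 * W0 * (kap a * Nc a `^ (1 - q^-1))) `^ q * centers_energy a.
Proof.
have N0 : 0 < Nc a := lt_le_trans ltr01 (Nc_ge1 a).
apply: (@le_trans _ _ (\sum_(b < (e a).+1) kap a `^ q * (2 `^ q * Nc a `^ (q - 1)) *
   \sum_(i < a | center_of T a i) transfer i a b `^ q)).
  apply: ler_sum => b _; rewrite powRM ?sumr_ge0// => [|i _]; last exact: transfer_ge0.
  rewrite -mulrA ler_wpM2l ?powR_ge0//.
  rewrite (eq_bigr (fun i : 'I_a => 1 * transfer i a b)); last by move=> i _; rewrite mul1r.
  rewrite [X in _ <= _ * X](eq_bigr (fun i : 'I_a => 1 * transfer i a b `^ q)); last first.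
    by move=> i _; rewrite mul1r.
  by apply: weighted_sum_le => // i; exact: transfer_ge0.
rewrite -mulr_sumr exchange_big/=.
apply: (@le_trans _ _ (kap a `^ q * (2 `^ q * Nc a `^ (q - 1)) *
    \sum_(i < a | center_of T a i) (2 * W0) `^ q * tier_energy i)).
  rewrite ler_wpM2l ?mulr_ge0 ?powR_ge0//; apply: ler_sum => i _.
  exact: sum_transfer_le.
rewrite -mulr_sumr le_eqVlt; apply/orP; left; apply/eqP.
move: W0 W0_gt0 => W W_gt0.
have -> : 4 * W * (kap a * Nc a `^ (1 - q^-1)) =
   kap a * (2 * Nc a `^ (1 - q^-1)) * (2 * W) by ring.
rewrite [in RHS]powRM ?mulr_ge0 ?powR_ge0 ?(ltW W_gt0)//.
rewrite [in RHS]powRM ?mulr_ge0 ?powR_ge0//.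
rewrite [(2 * Nc a `^ _) `^ q]powRM ?powR_ge0// -[(Nc a `^ _) `^ q]powRrM.
have -> : (1 - q^-1) * q = q - 1 by field; rewrite gt_eqF.
by rewrite /centers_energy; ring.
Qed.

End fixed_function.

Let lq_bounded_spread_const (q r : \bar R) (B S : R) (f : carrier T -> R) :
  (1 <= q)%E -> (1 <= r)%E -> recip r <= recip q -> 0 <= B ->
  (forall a, kap a * Nc a `^ (1 - recip q) * Lc a `^ recip r <= B) ->
  (forall x, 0 <= f x) -> 0 <= S ->
  lq_bounded T q (profile p f) S ->
  lq_bounded T r (profile p (spread f)) (8 * W0 * (1 + 2 * B) * S).
Proof.
move=> q1 r1 rq B0 hB f0 S0 xS.
set x := profile p f; set z := profile p (spread f).
have W00 := W0_gt0.
have x0 i c : 0 <= x i c by rewrite mulr_ge0 ?powR_ge0//; exact: star_ge0.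
have sf0 y : 0 <= spread f y.
  by rewrite addr_ge0// sumr_ge0// => c _; rewrite mulr_ge0// divr_ge0.
have z0 i c : 0 <= z i c by rewrite mulr_ge0 ?powR_ge0//; exact: star_ge0.
pose U a b := transfer f a a b.
pose V a b := kap a * \sum_(i < a | center_of T a i) transfer f i a b.
have U0 a b : 0 <= U a b by exact: transfer_ge0.
have V0 a b : 0 <= V a b.
  by rewrite mulr_ge0// sumr_ge0// => i _; exact: transfer_ge0.
have zUV a b : (b <= e a)%N -> z a b <= U a b + V a b.
  by move=> be; exact: profile_spread_le.
have L0 a : 0 < Lc a := lt_le_trans ltr01 (Lc_ge1 a).
have C0 : 0 <= 8 * W0 * (1 + 2 * B).
  apply: mulr_ge0; first by rewrite mulr_ge0// ltW.
  by rewrite addr_ge0// mulr_ge0.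
case: q q1 rq hB xS => [q|_|//]; last first.
  case: r r1 => [r|_|//]; last first.
    move=> _; rewrite recip_pinfty => hB xS a b be; apply: (le_trans (zUV _ _ be)).
    have tr i : transfer f i a b <= W0 * S.
      apply: (@le_trans _ _ (\sum_(c < (e i).+1) decay p ^+ gap (e i + b) (e a + c) * S)).
        apply: ler_sum => c _; rewrite ler_wpM2l//; apply: xS.
        by rewrite -ltnS.
      by rewrite -mulr_suml ler_wpM2r.
    have VB : V a b <= B * (W0 * S).
      apply: (@le_trans _ _ (kap a * (Nc a * (W0 * S)))).
        rewrite /V ler_wpM2l//.
        apply: (@le_trans _ _ (\sum_(i < a | center_of T a i) 1 * (W0 * S))).
          by apply: ler_sum => i _; rewrite mul1r.
        by rewrite -mulr_suml ler_wpM2r// mulr_ge0// ltW.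
      rewrite mulrA ler_wpM2r ?mulr_ge0 ?(ltW W00)//.
      have := hB a; rewrite subr0 powRr0 mulr1 powRr1//.
      exact: le_trans ler01 (Nc_ge1 a).
    have := tr a; rewrite -/(U a b).
    have : 0 <= W0 * S by rewrite mulr_ge0// ltW.
    have : 0 <= B * (W0 * S) by rewrite !mulr_ge0// ltW.
    have -> : 8 * W0 * (1 + 2 * B) * S = 8 * (W0 * S) + 16 * (B * (W0 * S)) by ring.
    lra.
  (* For [q = +oo] the condition [recip r <= recip q] excludes finite [r]. *)
  rewrite lee_fin => r1; rewrite recip_fin// recip_pinfty.
  by rewrite leNgt invr_gt0 (lt_le_trans ltr01 r1).
rewrite lee_fin => q1; rewrite recip_fin// => rq hB xS.
have q0 : 0 < q := lt_le_trans ltr01 q1.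
have Y0 i : 0 <= tier_energy f q i by exact: tier_energy_ge0.
have YS i : tier_energy f q i <= S `^ q.
  apply: le_trans (xS i.+1); rewrite big_ord_recr/= lerDr.
  by apply: sumr_ge0 => a _; apply: sumr_ge0 => b _; exact: powR_ge0.
have X0 a : 0 <= centers_energy f q a by apply: sumr_ge0.
have XS a : centers_energy f q a <= S `^ q.
  apply: le_trans (xS a); rewrite /centers_energy big_mkcond/=.
  by apply: ler_sum => i _; case: ifP => // _; exact: Y0.
have SU a := sum_transfer_le f0 q1 a a.
have SV a := sum_centers_transfer_le f0 q1 a.
have bq0 a : 0 <= kap a * Nc a `^ (1 - q^-1) by rewrite mulr_ge0 ?powR_ge0.
case: r r1 rq hB => [r|_|//]; last first.
  rewrite recip_pinfty => _ hB a b be.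
  have be' : (b < (e a).+1)%N by [].
  apply: (le_trans (zUV _ _ be)).
  have root (y t : R) : 0 <= y -> 0 <= t -> y `^ q <= t `^ q -> y <= t.
    move=> y0 t0; rewrite leNgt => /negP H; rewrite leNgt; apply/negP => ty.
    by apply: H; apply: gt0_ltr_powR; rewrite ?nnegrE.
  have UB : U a b <= 2 * W0 * S.
    apply: root => //; first by rewrite !mulr_ge0// ltW.
    apply: (@le_trans _ _ (\sum_(b < (e a).+1) U a b `^ q)).
      rewrite (bigD1 (Ordinal be'))//= lerDl.
      by apply: sumr_ge0 => i _; exact: powR_ge0.
    apply: (le_trans (SU a)); rewrite [leRHS]powRM ?mulr_ge0 ?(ltW W00)//.
    by rewrite ler_wpM2l ?powR_ge0.
  have VB : V a b <= 4 * W0 * B * S.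
    apply: (@le_trans _ _ (4 * W0 * (kap a * Nc a `^ (1 - q^-1)) * S)).
      apply: root => //; first by rewrite !mulr_ge0 ?powR_ge0// ltW.
      apply: (@le_trans _ _ (\sum_(b < (e a).+1) V a b `^ q)).
        rewrite (bigD1 (Ordinal be'))//= lerDl.
        by apply: sumr_ge0 => i _; exact: powR_ge0.
      apply: (le_trans (SV a)); rewrite [leRHS]powRM ?mulr_ge0 ?powR_ge0 ?(ltW W00)//.
      by rewrite ler_wpM2l ?powR_ge0.
    rewrite ler_wpM2r// ler_wpM2l ?mulr_ge0 ?(ltW W00)//.
    by have := hB a; rewrite powRr0 mulr1.
  have : 0 <= W0 * S by rewrite mulr_ge0// ltW.
  have : 0 <= W0 * B * S by rewrite !mulr_ge0// ltW.
  have -> : 8 * W0 * (1 + 2 * B) * S = 8 * (W0 * S) + 16 * (W0 * B * S) by ring.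
  lra.
rewrite lee_fin => r1; rewrite recip_fin// => rq hB A.
have r0 : 0 < r := lt_le_trans ltr01 r1.
have qr : q <= r by rewrite -lef_pV2.
have SUr a : \sum_(b < (e a).+1) U a b `^ r <=
    (2 * W0) `^ r * S `^ (r - q) * tier_energy f q a.
  apply: (@le_trans _ _ (((2 * W0) `^ q * tier_energy f q a) `^ (r / q))).
    apply: le_trans (sum_powR_le q0 qr _) _; first by move=> b; exact: U0.
    apply: ge0_ler_powR; rewrite ?nnegrE ?divr_ge0 ?(ltW r0) ?(ltW q0)//.
      by apply: sumr_ge0 => b _; exact: powR_ge0.
    by rewrite mulr_ge0 ?powR_ge0.
  rewrite powRM ?powR_ge0// -powRrM [q * _]mulrC divfK ?gt_eqF//.
  rewrite -mulrA; apply: ler_wpM2l; first exact: powR_ge0.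
  by rewrite [leRHS]mulrC; apply: powR_ratio_le; rewrite ?Y0 ?YS.
have SVr a : \sum_(b < (e a).+1) V a b `^ r <=
    (4 * W0 * B) `^ r * S `^ (r - q) * ((Lc a)^-1 * centers_energy f q a).
  apply: (@le_trans _ _ (((4 * W0 * (kap a * Nc a `^ (1 - q^-1))) `^ q *
      centers_energy f q a) `^ (r / q))).
    apply: le_trans (sum_powR_le q0 qr _) _; first by move=> b; exact: V0.
    apply: ge0_ler_powR; rewrite ?nnegrE ?divr_ge0 ?(ltW r0) ?(ltW q0)//.
      by apply: sumr_ge0 => b _; exact: powR_ge0.
    by rewrite mulr_ge0 ?powR_ge0.
  rewrite powRM ?powR_ge0// -[((4 * _ * _) `^ q) `^ _]powRrM.
  rewrite [q * (r / q)]mulrC divfK ?gt_eqF//.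
  have kB : (kap a * Nc a `^ (1 - q^-1)) `^ r <= B `^ r * (Lc a)^-1.
    have -> : B `^ r * (Lc a)^-1 = (B / Lc a `^ r^-1) `^ r.
      rewrite powRM ?invr_ge0 ?powR_ge0//; congr (_ * _).
      by rewrite -powRN -powRrM mulNr mulVf ?gt_eqF// powR_inv1// ltW.
    apply: ge0_ler_powR; rewrite ?nnegrE ?(ltW r0) ?divr_ge0 ?powR_ge0//.
    by rewrite ler_pdivlMr ?powR_gt0.
  have -> : (4 * W0 * B) `^ r * S `^ (r - q) * ((Lc a)^-1 * centers_energy f q a) =
     (4 * W0) `^ r * (B `^ r * (Lc a)^-1) * (centers_energy f q a * S `^ (r - q)).
    rewrite [(4 * W0 * B) `^ r]powRM ?mulr_ge0 ?(ltW W00)//; ring.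
  apply: ler_pM; rewrite ?powR_ge0//.
    rewrite [leLHS]powRM ?mulr_ge0 ?powR_ge0 ?(ltW W00)//.
    by rewrite ler_wpM2l ?powR_ge0.
  by apply: powR_ratio_le; rewrite ?X0 ?XS.
have YA : \sum_(a < A) tier_energy f q a <= S `^ q by exact: xS.
(* After exchanging the sums each center tier carries the total weight of its leaf tiers, at most 1
   by [card_leaves]. *)
have XA : \sum_(a < A) (Lc a)^-1 * centers_energy f q a <= S `^ q.
  apply: le_trans YA.
  apply: (@le_trans _ _ (\sum_(a < A) \sum_(i < A)
      (if center_of T a i then (Lc a)^-1 * tier_energy f q i else 0))).
    apply: ler_sum => a _; rewrite /centers_energy mulr_sumr.
    rewrite (big_ord_widen_cond A (fun i => center_of T a i)
      (fun i => (Lc a)^-1 * tier_energy f q i)); last exact: ltnW.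
    rewrite [leLHS]big_mkcond/=; apply: ler_sum => i _.
    case: (boolP (center_of T a i)) => //= ai.
    by case: ifP => // _; rewrite mulr_ge0// invr_ge0 ltW.
  rewrite exchange_big/=; apply: ler_sum => i _.
  by rewrite -big_mkcond/= -mulr_suml -[leRHS]mul1r ler_wpM2r ?card_leaves.
apply: (@le_trans _ _ (2 `^ r * ((2 * W0) `^ r * S `^ r + (4 * W0 * B) `^ r * S `^ r))).
  apply: (@le_trans _ _ (\sum_(a < A) 2 `^ r * ((2 * W0) `^ r * S `^ (r - q) * tier_energy f q a
      + (4 * W0 * B) `^ r * S `^ (r - q) * ((Lc a)^-1 * centers_energy f q a)))).
    apply: ler_sum => a _.
    apply: (@le_trans _ _ (2 `^ r * \sum_(b < (e a).+1) (U a b `^ r + V a b `^ r))).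
      rewrite mulr_sumr; apply: ler_sum => b _; apply: le_trans (powRD_le _ _ _) => //.
      apply: ge0_ler_powR; rewrite ?nnegrE ?(ltW r0) ?addr_ge0//.
      by apply: zUV; rewrite -ltnS.
    by rewrite ler_wpM2l ?powR_ge0// big_split/= lerD ?SUr ?SVr.
  rewrite -mulr_sumr ler_wpM2l ?powR_ge0// big_split/= -!mulr_sumr.
  have -> : S `^ r = S `^ (r - q) * S `^ q.
    by rewrite -powRD subrK// gt_eqF.
  rewrite !mulrA; apply: lerD; rewrite ler_wpM2l ?mulr_ge0 ?powR_ge0//.
rewrite -mulrDl mulrA -[leRHS]/((_ * S) `^ r) [leRHS]powRM// ler_wpM2r ?powR_ge0//.
apply: (@le_trans _ _ (2 `^ r * (2 * (2 * W0 + 4 * W0 * B)) `^ r)).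
  rewrite ler_wpM2l ?powR_ge0// addr_powR_le// ?mulr_ge0 ?(ltW W00)//.
rewrite -powRM ?mulr_ge0 ?addr_ge0 ?mulr_ge0 ?(ltW W00)//.
by rewrite le_eqVlt; apply/orP; left; apply/eqP; congr (_ `^ _); ring.
Qed.

Lemma lq_bounded_spread (q r : \bar R) (B : R) :
  (1 <= q)%E -> (1 <= r)%E -> recip r <= recip q -> 0 <= B ->
  (forall a, kap a * Nc a `^ (1 - recip q) * Lc a `^ recip r <= B) ->
  exists2 C : R, 0 <= C & forall (f : carrier T -> R) S, (forall x, 0 <= f x) ->
    0 <= S -> lq_bounded T q (profile p f) S ->
    lq_bounded T r (profile p (spread f)) (C * S).
Proof.
move=> q1 r1 rq B0 hB; exists (8 * W0 * (1 + 2 * B)).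
  apply: mulr_ge0; first by rewrite mulr_ge0// ltW.
  by rewrite addr_ge0// mulr_ge0.
by move=> f S f0 S0; exact: lq_bounded_spread_const.
Qed.

End spread_bounded.

(** * Layouts made of blocks *)

Lemma sum_pred_inj_ge (A M : nat) (P : pred nat) (F : nat -> nat) :
  (forall k, (k < M)%N -> (F k < A)%N && P (F k)) ->
  (forall k l, (k < M)%N -> (l < M)%N -> F k = F l -> k = l) ->
  (M <= \sum_(k < A) P k)%N.
Proof.
move=> FM Finj; rewrite -(big_mkord xpredT (fun k => P k : nat)) /index_iota subn0.
rewrite (eq_bigr (fun k => if P k then 1%N else 0%N)); last by move=> k _; case: (P k).
rewrite -big_mkcond sum1_count -size_filter -[leqLHS](size_iota 0) -(size_map F).
apply: uniq_leq_size.
  rewrite map_inj_in_uniq ?iota_uniq// => k l.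
  by rewrite !mem_iota !add0n; exact: Finj.
move=> _ /mapP[k + ->]; rewrite mem_filter !mem_iota !add0n => /FM/andP[FA PF].
by rewrite PF FA.
Qed.

(* Tier [a] is the tier number [slot a] of block [blk a], where
   [a + 1 = 2 ^ blk a * (2 * slot a + 1)]. *)
Definition blk (a : nat) : nat := logn 2 a.+1.
Definition slot (a : nat) : nat := (a.+1 %/ 2 ^ blk a)./2.
Definition tier (i s : nat) : nat := (2 ^ i * s.*2.+1).-1.

Lemma tierS i s : (tier i s).+1 = (2 ^ i * s.*2.+1)%N.
Proof. by rewrite prednK// muln_gt0 expn_gt0. Qed.

Lemma blk_tier i s : blk (tier i s) = i.
Proof.
rewrite /blk tierS lognM ?expn_gt0// pfactorK// logn_coprime ?addn0//.
by rewrite coprime2n /= odd_double.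
Qed.

Lemma slot_tier i s : slot (tier i s) = s.
Proof. by rewrite /slot blk_tier tierS mulKn ?expn_gt0//= uphalf_double. Qed.

Lemma tier_blk_slot a : tier (blk a) (slot a) = a.
Proof.
apply: succn_inj; rewrite tierS /slot /blk.
have [m + aE] := pfactor_coprime (isT : prime 2) (ltn0Sn a).
rewrite coprime2n => om; rewrite {2}aE mulnK ?expn_gt0//.
have -> : (m./2).*2.+1 = m by rewrite -[RHS]odd_double_half om.
by rewrite mulnC -aE.
Qed.

Lemma tier_ge i s : (s <= tier i s)%N.
Proof.
rewrite -ltnS tierS; have : (0 < 2 ^ i)%N by rewrite expn_gt0.
by rewrite -muln2; nia.
Qed.

Lemma tier_lt i s s' : (s < s')%N -> (tier i s < tier i s')%N.
Proof.
by move=> ss; rewrite -ltnS !tierS ltn_pmul2l ?expn_gt0// ltnS ltn_double.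
Qed.

Lemma slot_inj a b : blk a = blk b -> slot a = slot b -> a = b.
Proof. by move=> ab sab; rewrite -(tier_blk_slot a) ab sab tier_blk_slot. Qed.

Section block_combinatorics.
Context (N L : nat -> nat).

(** The slots below [N] are the centers of a block, the next [L] its leaves; the later ones are
    nonleaf tiers joined to no leaf. *)
Definition is_leaf a := (N (blk a) <= slot a < N (blk a) + L (blk a))%N.
Definition is_center a c :=
  [&& is_leaf a, blk c == blk a & (slot c < N (blk a))%N].
Lemma is_center_lt a c : is_center a c -> (c < a)%N.
Proof.
case/and3P => /andP[la _] /eqP bc sc.
rewrite -(tier_blk_slot a) -(tier_blk_slot c) bc; apply: tier_lt.
exact: leq_trans sc la.
Qed.

Lemma is_center_nonleaf a c : is_center a c -> ~~ is_leaf c.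
Proof.
by case/and3P => _ /eqP bc sc; rewrite /is_leaf bc negb_and -ltnNge sc.
Qed.

Lemma inf_nonleaf n : exists2 a, (n <= a)%N & ~~ is_leaf a.
Proof.
exists (tier 0 (n + (N 0 + L 0))%N).
  exact: leq_trans (leq_addr _ _) (tier_ge _ _).
by rewrite /= /is_leaf blk_tier slot_tier negb_and -[X in _ || X]leqNgt leq_addl orbT.
Qed.

Lemma card_centersE a : is_leaf a ->
  (\sum_(i < a) is_center a i = N (blk a))%N.
Proof.
move=> la; apply/eqP; rewrite eqn_leq; apply/andP; split.
  apply: (@sum_pred_inj_le a (N (blk a)) (is_center a) slot).
    by move=> k _ /and3P[].
  move=> k l _ _ /and3P[_ /eqP kb _] /and3P[_ /eqP lb _].
  by apply: slot_inj; rewrite kb lb.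
apply: (@sum_pred_inj_ge a (N (blk a)) (is_center a) (tier (blk a))).
  move=> k kN; have ac : is_center a (tier (blk a) k).
    by rewrite /is_center la blk_tier slot_tier eqxx.
  by rewrite ac is_center_lt.
by move=> k l _ _ /(congr1 slot); rewrite !slot_tier.
Qed.

Lemma card_leaves_le i A : (\sum_(a < A) is_center a i <= L (blk i))%N.
Proof.
apply: (@sum_pred_inj_le A (L (blk i)) (is_center ^~ i) (fun a => slot a - N (blk i))%N).
  by move=> a _ /and3P[/andP[lo la] /eqP -> _]; rewrite ltn_subLR.
move=> a b _ _ /and3P[/andP[la _] /eqP ai _] /and3P[/andP[lb _] /eqP bi _].
move=> H; apply: slot_inj; first by rewrite -ai -bi.
by rewrite -ai in la; rewrite -bi in lb; lia.
Qed.

Lemma card_leaves_ge i : exists A,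
  (L i <= \sum_(a < A) (is_leaf a && (blk a == i)))%N.
Proof.
exists (tier i (N i + L i)).+1.
apply: (@sum_pred_inj_ge _ (L i) (fun a => is_leaf a && (blk a == i))
  (fun s => tier i (N i + s))).
  move=> k kL; rewrite /is_leaf blk_tier slot_tier eqxx leq_addr ltn_add2l kL !andbT.
  by rewrite ltnS ltnW// tier_lt// ltn_add2l.
by move=> k l _ _ /(congr1 slot); rewrite !slot_tier; lia.
Qed.

End block_combinatorics.

(** * Recursive choice of exponents and masses *)

Section layout_construction.
Context (R : realType) (p : R) (N L : nat -> nat) (K : nat -> R).
Hypothesis p1 : 1 < p.
Hypothesis N_gt0 : forall i, (0 < N i)%N.
Hypothesis K_gt0 : forall i, 0 < K i.

Local Notation is_leaf := (is_leaf N L).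
Local Notation is_center := (is_center N L).

Definition leaf_coef a : R := K (blk a) / (N (blk a))%:R.
Definition tier_coef a : R := if is_leaf a then leaf_coef a else 1.
(** The solution [m] of [m]^ (1 - p^-1) = 2 [^ (E / p) / tier_coef a], which gives [scaled] with
    factor [leaf_coef a] between a leaf tier and its centers. *)
Definition tier_mass a (E : nat) : R := (2 ^+ E / tier_coef a `^ p) `^ (p - 1)^-1.

Lemma leaf_coef_gt0 a : 0 < leaf_coef a.
Proof. by rewrite divr_gt0// ltr0n. Qed.

Lemma tier_coef_gt0 a : 0 < tier_coef a.
Proof. by rewrite /tier_coef; case: ifP => // _; exact: leaf_coef_gt0. Qed.

Lemma tier_mass_gt0 a E : 0 < tier_mass a E.
Proof. by rewrite powR_gt0// divr_gt0 ?exprn_gt0// powR_gt0// tier_coef_gt0. Qed.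

Lemma tier_mass_unbounded a (E0 : nat) (Z : R) :
  exists E, (E0 <= E)%N /\ Z <= tier_mass a E.
Proof.
have [Z0|Z0] := leP Z 0.
  by exists E0; split => //; rewrite (le_trans Z0)// ltW// tier_mass_gt0.
have c0 : 0 < tier_coef a `^ p by rewrite powR_gt0// tier_coef_gt0.
have p10 : 0 < p - 1 by rewrite subr_gt0.
exists (maxn E0 (Num.truncn (Z `^ (p - 1) * tier_coef a `^ p)).+1).
split; first exact: leq_maxl.
apply: (@le_trans _ _ ((Z `^ (p - 1)) `^ (p - 1)^-1)).
  by rewrite -powRrM divff ?gt_eqF// powRr1// ltW.
apply: ge0_ler_powR; rewrite ?nnegrE ?invr_ge0 ?(ltW p10) ?powR_ge0//.
  by rewrite divr_ge0 ?exprn_ge0 ?(ltW c0).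
rewrite ler_pdivlMr//.
set x := (X in X <= _); rewrite (le_trans (ltW (truncnS_gt x)))//.
rewrite -natrX ler_nat; apply: leq_trans (leq_maxr E0 _) _.
by rewrite ltnW// ltn_expl.
Qed.

(** The mass grows with the exponent, so one large exponent secures monotonicity, mass at least 1
    and lacunarity together. *)
Definition next_exp a (E0 : nat) (S : R) : nat :=
  sval (cid (tier_mass_unbounded a E0 (Num.max 1 (2 * S)))).

(** The state of the recursion: the previous exponent and the total mass of the tiers already
    chosen. *)
Fixpoint prefix (a : nat) : nat * R :=
  if a is a'.+1 then
    let E := next_exp a' (prefix a').1 (prefix a').2 in
    (E, (prefix a').2 + tier_mass a' E * 2 ^+ E)
  else (0%N, 0).

Definition tier_exp a := next_exp a (prefix a).1 (prefix a).2.

Definition block_layout : layout R :=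
  Layout tier_exp (fun a => PosNum (tier_mass_gt0 a (tier_exp a))) is_leaf is_center.

Local Notation T := block_layout.
Local Notation e := tier_exp.
Local Notation m a := (lmass T a)%:num.

Lemma next_expP a E0 S : [/\ (E0 <= next_exp a E0 S)%N,
  1 <= tier_mass a (next_exp a E0 S) & 2 * S <= tier_mass a (next_exp a E0 S)].
Proof.
rewrite /next_exp; case: cid => E [E0E] /=; rewrite ge_max => /andP[h1 h2].
by split.
Qed.

Lemma tier_mass_ge1 a : 1 <= m a.
Proof. by case: (next_expP a (prefix a).1 (prefix a).2). Qed.

Lemma tier_exp_mono : {homo tier_exp : a b / (a <= b)%N}.
Proof.
apply: homo_leq => [a|b a c|a]; [exact: leqnn|exact: leq_trans|].
by have [+ _ _] := next_expP a.+1 (prefix a.+1).1 (prefix a.+1).2.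
Qed.

Lemma prefix_sum a : (prefix a).2 = \sum_(i < a) m i * 2 ^+ e i.
Proof. by elim: a => [|a IH]; rewrite ?big_ord0// big_ord_recr/= -IH. Qed.

Lemma block_layout_lacunary : lacunary T.
Proof.
by move=> a; rewrite -prefix_sum; case: (next_expP a (prefix a).1 (prefix a).2).
Qed.

Lemma tier_mass_powR a : m a `^ (1 - p^-1) = 2 `^ ((e a)%:R / p) / tier_coef a.
Proof.
have p0 : 0 < p := lt_trans ltr01 p1.
rewrite /= /tier_mass -powRrM.
have -> : (p - 1)^-1 * (1 - p^-1) = p^-1.
  by field; rewrite gt_eqF//= subr_eq0 gt_eqF.
rewrite powRM ?exprn_ge0 ?invr_ge0 ?powR_ge0//; congr (_ * _).
  by rewrite -powR_mulrn// -powRrM.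
rewrite -powRN -powRrM mulNr divff ?gt_eqF//.
by rewrite powR_inv1// ltW// tier_coef_gt0.
Qed.

(** All that later arguments use, so that the recursive choice of exponents stays opaque. *)
Record block_layout_spec (U : layout R) : Prop := BlockLayoutSpec {
  spec_leaf : forall a, leaf U a = is_leaf a;
  spec_center : forall a c, center_of U a c = is_center a c;
  spec_mono : {homo lexp U : a b / (a <= b)%N};
  spec_mass_ge1 : forall a, 1 <= (lmass U a)%:num;
  spec_lacunary : lacunary U;
  spec_mass : forall a, (lmass U a)%:num `^ (1 - p^-1) =
    2 `^ ((lexp U a)%:R / p) / tier_coef a }.

Lemma block_layout_exists : exists U, block_layout_spec U.
Proof.
exists T; exact: (BlockLayoutSpec (U := T) (fun=> erefl) (fun _ _ => erefl)
  tier_exp_mono tier_mass_ge1 block_layout_lacunary tier_mass_powR).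
Qed.

Definition spread_coef a : R := if is_leaf a then leaf_coef a else 0.

Section block_layout.
Context (U : layout R) (spec : block_layout_spec U).
Local Notation eU := (lexp U).

Lemma spec_centerP a c : center_of U a c -> [/\ leaf U a, ~~ leaf U c & (c < a)%N].
Proof.
rewrite (spec_center spec) !(spec_leaf spec) => ac.
by split; [case/and3P: ac|exact: is_center_nonleaf ac|exact: is_center_lt ac].
Qed.

Lemma spec_inf_nonleaf n : exists2 a, (n <= a)%N & ~~ leaf U a.
Proof. by have [a na la] := inf_nonleaf N L n; exists a; rewrite ?(spec_leaf spec). Qed.

Lemma spec_center_lt a c : center_of U a c -> (c < a)%N /\ (eU c <= eU a)%N.
Proof.
by move=> /spec_centerP[_ _ ca]; split=> //; apply: (spec_mono spec); exact: ltnW.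
Qed.

Lemma spec_scaled a c : center_of U a c -> scaled U p (spread_coef a) c a.
Proof.
rewrite (spec_center spec) => ac.
rewrite /scaled !(spec_mass spec) /tier_coef /spread_coef.
rewrite (negbTE (is_center_nonleaf ac)).
have -> : is_leaf a by case/and3P: ac.
have c0 := leaf_coef_gt0 a.
have -> : 2 `^ (((eU c)%:R - (eU a)%:R) / p) =
    2 `^ ((eU c)%:R / p) / 2 `^ ((eU a)%:R / p) :> R.
  by rewrite mulrBl powRB// pnatr_eq0 implybT.
have d0 : 0 < 2 `^ ((eU a)%:R / p) :> R by rewrite powR_gt0.
move: (2 `^ _) (2 `^ _) d0 => u v d0.
by field; rewrite !gt_eqF.
Qed.

End block_layout.
End layout_construction.

(** * Best constants *)

Section profile_comparison.
Context (R : realType) (U : layout R) (p : R).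
Local Notation e := (lexp U).
Local Notation m a := (lmass U a)%:num.
Local Notation X := (layout_space U).

Lemma le_star (h1 h2 : carrier U -> R) a b : (b <= e a)%N ->
  (forall k, (k < 2 ^ e a)%N -> h1 (a, k) <= h2 (a, k)) ->
  star h1 a b <= star h2 a b.
Proof.
move=> be h12; rewrite le_starE//.
apply: (@leq_trans (level_card h1 a (star h1 a b))); first by rewrite -le_starE.
apply: leq_sum => k _; have := h12 k (ltn_ord k).
by case: (leP (star h1 a b) (h1 (a, k : nat))) => // H1 H2; rewrite (le_trans H1 H2).
Qed.

Lemma star_ge (h : carrier U -> R) a b t : (b <= e a)%N ->
  (forall k, (k < 2 ^ e a)%N -> t <= h (a, k)) -> t <= star h a b.
Proof.
move=> be th; rewrite le_starE// /level_card.
rewrite (eq_bigr (fun=> 1%N)); first by rewrite sum1_card card_ord leq_exp2l.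
by move=> k _; rewrite th.
Qed.

Lemma le_lq_bounded (q : \bar R) (x y : nat -> nat -> R) S : (1 <= q)%E ->
  (forall a b, (b <= e a)%N -> 0 <= x a b <= y a b) ->
  lq_bounded U q y S -> lq_bounded U q x S.
Proof.
case: q => [q| |//] q1 xy yS => [A|a b be]; last first.
  by case/andP: (xy a b be) => _ /le_trans; apply; exact: yS.
apply: le_trans (yS A); apply: ler_sum => a _; apply: ler_sum => b _.
have /andP[x0 xyab] := xy a b (ltn_ord b).
rewrite lee_fin in q1; apply: ge0_ler_powR => //; rewrite ?nnegrE//.
  exact: le_trans ler01 q1.
exact: le_trans x0 xyab.
Qed.

(** The points outside the tiers have mass zero. *)
Lemma lorentz_norm_active (q : \bar R) (G H : X -> \bar R) :
  (forall x, (x.2 < 2 ^ e x.1)%N -> G x = H x) ->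
  lorentz_norm p q G = lorentz_norm p q H.
Proof.
move=> GH; suff dE : dist_fun G = dist_fun H by rewrite /lorentz_norm dE.
apply/funext => t.
  rewrite /dist_fun !carrier_measureE; apply: eq_eseriesr => a _.
  congr (_%:E); rewrite /tier_sum; congr (_ * _); apply: eq_bigr => k _.
  rewrite !indicE; congr (nat_of_bool _)%:R.
  by apply/idP/idP => /set_mem/= h; apply/mem_set; move: h; rewrite /= (GH (a, k : nat) (ltn_ord k)).
Qed.

Lemma lorentz_norm_ge0 (q : \bar R) (G : X -> \bar R) : (0 <= lorentz_norm p q G)%E.
Proof.
case: q => [q| |//]; first by rewrite mule_ge0 ?poweR_ge0// lee_fin powR_ge0.
apply: le_ereal_sup_tmp; exists (1%:E * dist_fun G 1 `^ p^-1)%E.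
  by exists 1 => //=; rewrite in_itv/= ltr01.
by rewrite mule_ge0 ?poweR_ge0// lee_fin.
Qed.

(** The bound by [spread] makes the maximal function finite at the points of the tiers; at the other
    points, of mass zero, the value 0 is harmless. *)
Definition real_maximal (f : X -> R[i]) (x : carrier U) : R :=
  if (x.2 < 2 ^ e x.1)%N then fine (maximal f x) else 0.

Lemma maximal_ge0 (f : X -> R[i]) x : (0 <= maximal f x)%E.
Proof.
apply: le_ereal_sup_tmp; exists (average f (ball x 1)); first by exists 1 => //=.
rewrite /average; case: ifP => // _; rewrite mule_ge0 ?inve_ge0//.
by apply: integral_ge0 => y _; rewrite lee_fin normc_ge0.
Qed.

Lemma real_maximal_ge0 f x : 0 <= real_maximal f x.
Proof. by rewrite /real_maximal; case: ifP => // _; rewrite fine_ge0// maximal_ge0. Qed.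

End profile_comparison.

(** * Sufficiency and necessity of the condition on the blocks *)

Section best_const_bounds.
Context (R : realType) (p : R) (N L : nat -> nat) (K : nat -> R) (U : layout R).
Local Notation e := (lexp U).
Local Notation m a := (lmass U a)%:num.
Local Notation X := (layout_space U).
Hypothesis p1 : 1 < p.
Hypothesis N_gt0 : forall i, (0 < N i)%N.
Hypothesis L_gt0 : forall i, (0 < L i)%N.
Hypothesis K_gt0 : forall i, 0 < K i.
Hypothesis spec : block_layout_spec p N L K U.

Let p0 : 0 < p. Proof. exact: lt_trans ltr01 p1. Qed.
Let lac := spec_lacunary spec.
Let maximal_le (f : X -> R[i]) x :
  (x.2 < 2 ^ e x.1)%N ->
  (maximal f x <= (spread (fun y => Normc.normc (f y)) x)%:E)%E.
Proof.
by apply: maximal_le_spread;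
  [exact: spec_centerP spec|exact: spec_inf_nonleaf spec|exact: spec_mass_ge1 spec].
Qed.

Let maximalE (f : X -> R[i]) x :
  (x.2 < 2 ^ e x.1)%N -> maximal f x = (real_maximal f x)%:E.
Proof.
move=> xe; rewrite /real_maximal xe fineK// ge0_fin_numE ?maximal_ge0//.
exact: le_lt_trans (maximal_le f xe) (ltry _).
Qed.

Let norm_maximalE (f : X -> R[i]) q :
  lorentz_norm p q (maximal f) = lorentz_norm (X := X) p q (EFin \o real_maximal f).
Proof. by apply: lorentz_norm_active => x xe; rewrite maximalE. Qed.

(** The norm of [f] controls its profile, [lq_bounded_spread] passes to the profile of [spread],
    which dominates that of the maximal function, and the latter controls the norm. *)
Lemma best_const_lty (q r : \bar R) (B : R) :
  (1 <= q)%E -> (1 <= r)%E -> recip r <= recip q ->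
  (forall i, K i * (N i)%:R `^ (- recip q) * (L i)%:R `^ recip r <= B) ->
  (best_const X p q r < +oo)%E.
Proof.
move=> q1 r1 rq KB.
have N0 a : 0 < (N a)%:R :> R by rewrite ltr0n.
have B0 : 0 <= B.
  apply: le_trans (KB 0%N); rewrite !mulr_ge0 ?powR_ge0//; exact: ltW.
have [C2 C20 sp] : exists2 C : R, 0 <= C & forall (f : carrier U -> R) S,
    (forall x, 0 <= f x) -> 0 <= S -> lq_bounded U q (profile p f) S ->
    lq_bounded U r (profile p (spread f)) (C * S).
  apply: (@lq_bounded_spread R U p (spread_coef N L K) (fun a => (N (blk a))%:R)
     (fun a => (L (blk a))%:R) p1 _ _ _ _ _ _ _ q r B) => //.
  - exact: spec_center_lt spec.
  - by move=> a; rewrite /spread_coef; case: ifP => // _; rewrite ltW// leaf_coef_gt0.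
  - exact: spec_scaled spec.
  - by move=> a; rewrite ler1n.
  - by move=> a; rewrite ler1n.
  - move=> a.
    have -> : \sum_(i < a | center_of U a i) 1 = (\sum_(i < a) is_center N L a i)%:R :> R.
      rewrite natr_sum big_mkcond/=; apply: eq_bigr => i _.
      by rewrite (spec_center spec); case: is_center.
    have [la|la] := boolP (is_leaf N L a); first by rewrite card_centersE.
    by rewrite big1// => i _; rewrite /is_center (negbTE la).
  - move=> i A.
    apply: (@le_trans _ _ ((\sum_(a < A) is_center N L a i)%:R / (L (blk i))%:R)).
      rewrite natr_sum mulr_suml big_mkcond/=; apply: ler_sum => a _.
      rewrite (spec_center spec); case: (boolP (is_center N L a i)) => [/and3P[_ /eqP -> _]|_].
        by rewrite mul1r.
      by rewrite mul0r.
    by rewrite ler_pdivrMr ?ltr0n// mul1r ler_nat card_leaves_le.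
  (* On leaves [leaf_coef] is [K / N], and [K / N * N]^ (1 - recip q) = K * N [^ (- recip q)]. *)
  - move=> a; rewrite /spread_coef; case: ifPn => _; last by rewrite !mul0r.
    apply: le_trans (KB (blk a)); rewrite /leaf_coef le_eqVlt; apply/orP; left.
    rewrite powRD; last by rewrite (gt_eqF (N0 _)) implybT.
    by rewrite powRr1 ?(ltW (N0 _))//; apply/eqP; field; rewrite gt_eqF.
have [C1 C10 low] := lorentz_norm_ge p1 lac q1.
apply: (@le_lt_trans _ _ (4 * p * (C2 * C1))%:E); last exact: ltry.
apply: ereal_inf_lbound; exists (4 * p * (C2 * C1)) => //; split.
  by rewrite mulr_ge0 ?mulr_ge0// ltW.
move=> f [_]; set g := fun y => Normc.normc (f y).
have g0 y : 0 <= g y by exact: normc_ge0.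
have : (0 <= lorentz_norm p q (modulus f))%E by exact: lorentz_norm_ge0.
case EV : (lorentz_norm p q (modulus f)) => [V| |]//; rewrite lee_fin => V0 _.
have xS := low g V g0 V0 _; rewrite norm_maximalE -EFinM.
have C1V : 0 <= C1 * V by rewrite mulr_ge0.
have -> : 4 * p * (C2 * C1) * V = 4 * p * (C2 * (C1 * V)) by ring.
apply: lorentz_norm_le => //; first by rewrite mulr_ge0.
  exact: real_maximal_ge0.
have xV : lq_bounded U q (profile p g) (C1 * V) by apply: xS; rewrite -EV.
apply: le_lq_bounded (sp g _ g0 C1V xV) => // a b be.
have P0 : 0 <= block_mass U a b `^ p^-1 by exact: powR_ge0.
rewrite mulr_ge0 ?star_ge0 //=; last by move=> x; exact: real_maximal_ge0.
rewrite /profile ler_wpM2l//; apply: le_star => // k ke.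
by rewrite -lee_fin -maximalE//; exact: maximal_le.
Qed.

Definition is_block_center i a := (blk a == i) && (slot a < N i)%N.

(** The height is the inverse mass, so every center point of block [i] carries integral 1 and a leaf
    collects [N i] divided by its own mass. *)
Definition test_fun i (x : carrier U) : R :=
  if is_block_center i x.1 then (m x.1)^-1 else 0.

Lemma test_fun_ge0 i x : 0 <= test_fun i x.
Proof. by rewrite /test_fun; case: ifP => // _; rewrite invr_ge0. Qed.

Lemma is_block_center_nonleaf i a : is_block_center i a -> ~~ is_leaf N L a.
Proof. by case/andP => /eqP bi si; rewrite /is_leaf bi negb_and -ltnNge si. Qed.

Let mass_split a : m a = m a `^ p^-1 * m a `^ (1 - p^-1).
Proof.
rewrite -powRD; first by rewrite addrC subrK powRr1.
by rewrite addrC subrK oner_eq0.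
Qed.

Let powR2_expr (b : nat) : (2 ^+ b) `^ p^-1 = 2 `^ (b%:R / p) :> R.
Proof. by rewrite -powR_mulrn// powRrM. Qed.

Lemma profile_test_fun i a b : is_block_center i a ->
  profile p (test_fun i) a b = 2 `^ ((b%:R - (e a)%:R) / p).
Proof.
move=> ia; rewrite /profile.
have -> : star (test_fun i) a b = (m a)^-1 by rewrite /star /ranked /test_fun/= ia.
have -> : (m a)^-1 = (m a `^ p^-1 * m a `^ (1 - p^-1))^-1 by rewrite -mass_split.
rewrite /block_mass powRM// powR2_expr (spec_mass spec).
rewrite /tier_coef (negbTE (is_block_center_nonleaf ia)) divr1.
rewrite mulrBl powRB; last by rewrite pnatr_eq0 implybT.
have : 0 < 2 `^ ((e a)%:R / p) :> R by rewrite powR_gt0.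
have : 0 < m a `^ p^-1 by rewrite powR_gt0.
move: (m a `^ _) (2 `^ _) (2 `^ _) => u v w u0 w0.
by field; rewrite !gt_eqF.
Qed.

Lemma profile_test_fun0 i a b : ~~ is_block_center i a -> profile p (test_fun i) a b = 0.
Proof.
by move=> ia; rewrite /profile /star /ranked /test_fun/= (negbTE ia) mulr0.
Qed.

(** On each of the [N i] center tiers the profile is a geometric sequence in [e a - b], with l^q
    norm bounded independently of the tier. *)
Lemma lq_bounded_test_fun (q : \bar R) : (1 <= q)%E -> exists2 C : R, 0 <= C &
  forall i, lq_bounded U q (profile p (test_fun i)) (C * (N i)%:R `^ recip q).
Proof.
case: q => [q| |//]; last first.
  move=> _; exists 1 => // i a b be; rewrite recip_pinfty powRr0 mulr1.
  have [ia|ia] := boolP (is_block_center i a); last by rewrite profile_test_fun0.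
  rewrite profile_test_fun// -[leRHS](powRr0 2); apply: ler_powR; first by rewrite ler1n.
  by rewrite mulr_le0_ge0 ?invr_ge0 ?(ltW p0)// subr_le0 ler_nat.
rewrite lee_fin => q1; have q0 : 0 < q := lt_le_trans ltr01 q1.
set lam : R := 2 `^ (- (q / p)).
have l01 : 0 <= lam < 1 by rewrite powR_ge0/= powR2N_lt1// divr_gt0.
have W0 : 0 <= 2 / (1 - lam) by case/andP: l01 => _ l1; rewrite divr_ge0// subr_ge0 ltW.
exists ((2 / (1 - lam)) `^ q^-1); first exact: powR_ge0.
move=> i A; rewrite recip_fin// powRM ?powR_ge0// -!powRrM mulVf ?gt_eqF// !powRr1//.
apply: (@le_trans _ _ (\sum_(a < A) (2 / (1 - lam)) * (is_block_center i a)%:R)).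
  apply: ler_sum => a _; have [ia|ia] := boolP (is_block_center i a); last first.
    rewrite big1 ?mulr0// => b _.
    by rewrite profile_test_fun0// powR0// gt_eqF.
  rewrite mulr1; apply: le_trans (sum_kernel_le l01 0 (e a) (e a).+1).
  apply: ler_sum => b _; rewrite profile_test_fun// add0n.
  have be : (b <= e a)%N by rewrite -ltnS.
  rewrite /gap (_ : (b - e a = 0)%N) ?add0n; last by apply/eqP; rewrite subn_eq0.
  have -> : lam ^+ (e a - b) = 2 `^ (- (q / p) * (e a - b)%:R).
    by rewrite -powR_mulrn ?powR_ge0// powRrM.
  rewrite -powRrM natrB//.
  by rewrite le_eqVlt; apply/orP; left; apply/eqP; congr (_ `^ _); ring.
rewrite -mulr_sumr ler_wpM2l// -natr_sum ler_nat.
apply: (@sum_pred_inj_le A (N i) (is_block_center i) slot).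
  by move=> k _ /andP[].
move=> k l _ _ /andP[/eqP kb _] /andP[/eqP lb _] kl.
by apply: slot_inj; rewrite // kb lb.
Qed.

Lemma spread_test_fun i a k : is_leaf N L a -> blk a = i ->
  (N i)%:R / m a <= spread (test_fun i) (a, k).
Proof.
move=> la ai; rewrite /spread/= ler_wpDl ?test_fun_ge0//.
have -> : (N i)%:R = \sum_(c < a | center_of U a c) 1 :> R.
  rewrite -ai -(card_centersE la) natr_sum [RHS]big_mkcond/=; apply: eq_bigr => c _.
  by rewrite (spec_center spec); case: is_center.
rewrite mulr_suml; apply: ler_sum => c; rewrite (spec_center spec) /test_fun/=.
case/and3P => _ ca sc; rewrite /is_block_center -ai ca sc.
by rewrite mul1r mulrAC divff ?mul1r// gt_eqF.
Qed.

Lemma sum_center_mass_le a : \sum_(c < a | center_of U a c) m c <= m a.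
Proof.
have := lac a; set s := \sum_(i < a) _ => sm.
have s0 : 0 <= s by apply: sumr_ge0 => i _; rewrite mulr_ge0.
apply: (@le_trans _ _ s); last by lra.
rewrite big_mkcond/=; apply: ler_sum => c _; case: ifP => _; last by rewrite mulr_ge0.
by rewrite ler_peMr// exprn_ege1// ler1n.
Qed.

Lemma profile_maximal_test_fun i a : is_leaf N L a -> blk a = i ->
  K i / 2 <= profile p (real_maximal (fun x : X => (test_fun i x)%:C%C)) a (e a).
Proof.
move=> la ai; set f := fun x : X => _.
have gE y : Normc.normc (f y) = test_fun i y.
  by rewrite /f /Normc.normc/= expr0n/= addr0 sqrtr_sqr ger0_norm// test_fun_ge0.
have st : (N i)%:R / (2 * m a) <= star (real_maximal f) a (e a).
  apply: star_ge => // k ke; rewrite -lee_fin -maximalE//.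
  have ml := @spread_le_maximal R U (spec_centerP spec)
    f (a, k) ke.
  rewrite (spec_leaf spec) in ml; apply: le_trans (ml la (sum_center_mass_le a)).
  rewrite lee_fin (_ : (fun y => _) = test_fun i); last exact/funext.
  rewrite invfM mulrCA ler_wpM2l// spread_test_fun//.
apply: le_trans (ler_wpM2l (powR_ge0 _ _) st).
have -> : 2 * m a = 2 * (m a `^ p^-1 * m a `^ (1 - p^-1)) by rewrite -mass_split.
rewrite /block_mass powRM// powR2_expr (spec_mass spec).
rewrite /tier_coef la /leaf_coef ai.
have : 0 < 2 `^ ((e a)%:R / p) :> R by rewrite powR_gt0.
have : 0 < m a `^ p^-1 by rewrite powR_gt0.
have : 0 < (N i)%:R :> R by rewrite ltr0n.
have := K_gt0 i.
move: (m a `^ _) (2 `^ _) (K i) (N i)%:R => u v k n k0 n0 u0 v0.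
rewrite le_eqVlt; apply/orP; left; apply/eqP.
by field; rewrite !gt_eqF.
Qed.

Lemma best_const_bound (q r : \bar R) : (1 <= q)%E -> (1 <= r)%E ->
  (best_const X p q r < +oo)%E ->
  exists B : R, forall i, K i * (N i)%:R `^ (- recip q) * (L i)%:R `^ recip r <= B.
Proof.
move=> q1 r1 /ereal_inf_lt[_ [C [C0 HC] <-] _].
have [C1 C10 low] := lorentz_norm_ge p1 lac r1.
have [Ct Ct0 tb] := lq_bounded_test_fun q1.
exists (2 * (C1 * (C * (4 * p * Ct)))) => i.
set f := fun x : X => (test_fun i x)%:C%C.
have gE : modulus f = (EFin \o test_fun i).
  apply/funext => y; rewrite /modulus/=; congr (_%:E).
  by rewrite /f /Normc.normc/= expr0n/= addr0 sqrtr_sqr ger0_norm// test_fun_ge0.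
have N0 : 0 < (N i)%:R :> R by rewrite ltr0n.
set u := (N i)%:R `^ recip q in tb *.
have u0 : 0 < u by rewrite powR_gt0.
have Cu0 : 0 <= Ct * u by rewrite mulr_ge0// ltW.
have nf : (lorentz_norm p q (modulus f) <= (4 * p * (Ct * u))%:E)%E.
  by rewrite gE; apply: lorentz_norm_le => //; exact: test_fun_ge0.
have fL : lorentz_space p q f.
  split; last exact: le_lt_trans nf (ltry _).
  exact: measurable_fun_carrier.
have C4 : 0 <= 4 * p * (Ct * u) by rewrite mulr_ge0// mulr_ge0// ltW.
have := low (real_maximal f) (C * (4 * p * (Ct * u))) (real_maximal_ge0 f).
rewrite mulr_ge0// -norm_maximalE => /(_ isT) low'.
have {low'} := low' (le_trans (HC f fL) (lee_wpmul2l _ nf)); rewrite lee_fin C0 => /(_ isT).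
set V := C1 * _ => bV.
suff H : K i * (L i)%:R `^ recip r <= 2 * V.
  rewrite powRN -/u mulrAC ler_pdivrMr//; apply: le_trans H _.
  by rewrite le_eqVlt; apply/orP; left; apply/eqP; rewrite /V; ring.
have V0 : 0 <= V by rewrite !mulr_ge0// ltW.
case: r r1 bV {low HC} => [r| |//].
  rewrite lee_fin => r1 bV; have r0 : 0 < r := lt_le_trans ltr01 r1.
  have [A LA] := card_leaves_ge N L i.
  have : (L i)%:R * (K i / 2) `^ r <= V `^ r.
    apply: le_trans (bV A).
    apply: (@le_trans _ _ (\sum_(a < A) (is_leaf N L a && (blk a == i))%:R * (K i / 2) `^ r)).
      by rewrite -mulr_suml -natr_sum ler_wpM2r ?powR_ge0// ler_nat.
    apply: ler_sum => a _; have [/andP[la /eqP ai]|_] := boolP (_ && _); last first.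
      by rewrite mul0r sumr_ge0// => b _; exact: powR_ge0.
    rewrite mul1r (bigD1 ord_max)//= ler_wpDr ?sumr_ge0// => [b _|]; first exact: powR_ge0.
    apply: ge0_ler_powR; rewrite ?nnegrE ?(ltW r0) ?divr_ge0 ?(ltW (K_gt0 i))//.
      rewrite mulr_ge0 ?powR_ge0//; apply: star_ge0; exact: real_maximal_ge0.
    exact: profile_maximal_test_fun.
  rewrite recip_fin// => H.
  have H2 : (L i)%:R `^ r^-1 * (K i / 2) <= V.
    have -> : V = (V `^ r) `^ r^-1 by rewrite -powRrM divff ?gt_eqF// powRr1.
    have -> : (L i)%:R `^ r^-1 * (K i / 2) = ((L i)%:R * (K i / 2) `^ r) `^ r^-1.
      rewrite powRM ?powR_ge0// -powRrM divff ?gt_eqF// powRr1//.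
      by rewrite divr_ge0// ltW.
    apply: ge0_ler_powR; rewrite ?nnegrE ?invr_ge0 ?(ltW r0) ?mulr_ge0 ?powR_ge0//.
  by move: H2; rewrite mulrA [_ * K i]mulrC; lra.
move=> _ bV; have [A] := card_leaves_ge N L i.
rewrite recip_pinfty powRr0 mulr1 => LA.
have [a /andP[la /eqP ai]] : exists a : 'I_A, is_leaf N L a && (blk a == i).
  apply/existsP; apply: contraT => /existsPn na.
  by move: LA; rewrite big1 ?leqn0 ?gtn_eqF// => a _; rewrite (negbTE (na a)).
have := le_trans (profile_maximal_test_fun la ai) (bV a (e a) (leqnn _)).
lra.
Qed.

End best_const_bounds.

(** * Regions *)

Section supporting_line.
Context (R : realType) (G : R -> R) (delta : R).

Definition three_point_concave := forall x y z,
  delta <= x -> x < y -> y < z -> z <= 1 ->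
  (G z - G y) * (y - x) <= (G y - G x) * (z - y).

Definition nondecreasing_on := forall x y,
  delta <= x -> x <= y -> y <= 1 -> G x <= G y.

Hypothesis Gconc : three_point_concave.
Hypothesis Gmono : nondecreasing_on.

(** The slope is the infimum of the slopes of the chords to the left of [u]: these exist even at
    [u = 1], are nonnegative by monotonicity, and exceed those of the chords to the right by
    concavity. *)
Lemma supporting_slope u : delta < u -> u <= 1 -> exists2 a, 0 <= a &
  forall v, delta <= v <= 1 -> G v <= G u + a * (v - u).
Proof.
move=> du u1.
pose E := [set (G u - G v) / (u - v) | v in [set v | delta <= v < u]].
have E0 : E !=set0.
  by exists ((G u - G delta) / (u - delta)); exists delta => //=; rewrite lexx.
have Epos x : E x -> 0 <= x.
  move=> [v /andP[dv vu] <-]; rewrite divr_ge0 ?subr_ge0 ?(ltW vu)//.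
  by apply: Gmono => //; exact: ltW.
have lbE : has_lbound E by exists 0 => x; exact: Epos.
exists (inf E); first exact: lb_le_inf.
move=> v /andP[dv v1]; case: (ltgtP v u) => [vu|uv|->]; last by rewrite subrr mulr0 addr0.
  have : inf E <= (G u - G v) / (u - v).
    by apply: ge_inf => //; exists v => //=; rewrite dv.
  rewrite ler_pdivlMr ?subr_gt0//; lra.
have : (G v - G u) / (v - u) <= inf E.
  apply: lb_le_inf => // _ [x /andP[dx xu] <-].
  rewrite ler_pdivrMr ?subr_gt0// mulrAC ler_pdivlMr ?subr_gt0//.
  exact: Gconc.
rewrite ler_pdivrMr ?subr_gt0//; lra.
Qed.

End supporting_line.

Lemma recip_bounds (R : realType) (q : \bar R) : (1 <= q)%E -> 0 <= recip q <= 1.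
Proof.
case: q => [q| |//] q1; last by rewrite /recip invey/= lexx ler01.
rewrite lee_fin in q1; have q0 : 0 < q := lt_le_trans ltr01 q1.
by rewrite /recip inver gt_eqF//= invr_ge0 invf_le1// q1 ltW.
Qed.

Lemma powR2_ge (R : realType) (x : R) : x <= 2 `^ x.
Proof.
have [x0|x0] := leP x 0; first exact: le_trans x0 (powR_ge0 _ _).
have := truncn_itv (ltW x0) => /andP[lo up].
apply: (le_trans (ltW up)); apply: (@le_trans _ _ (2 `^ (Num.truncn x)%:R)).
  by rewrite powR_mulrn// -natrX ler_nat ltn_expl.
by apply: ler_powR => //; rewrite ler1n.
Qed.

Lemma sub_quadratic_le (R : realType) (c : R) (n : nat) : 0 < c ->
  n%:R - c * n%:R ^+ 2 <= c^-1 :> R.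
Proof.
move=> c0; have n0 : 0 <= n%:R :> R by [].
have := sqr_ge0 (c * n%:R - 1); have cc : c * c^-1 = 1 by rewrite divff// gt_eqF.
have ci : 0 < c^-1 by rewrite invr_gt0.
move=> H; rewrite -(ler_pM2l c0) cc; nra.
Qed.

(** * Exponents of blocks that cut out a region *)

Section region.
Context (R : realType) (delta : R) (G : R -> R) (strict : bool).
Hypothesis delta01 : 0 <= delta <= 1.
Hypothesis Gconc : three_point_concave G delta.
Hypothesis Gmono : nondecreasing_on G delta.
Hypothesis Gbnd : forall u, delta <= u <= 1 -> -1 <= G u <= 1.

(** In the strict case the additional term [n] makes the exponents unbounded on the graph itself,
    while strictly below the graph a negative multiple of [n ^ 2] absorbs it. *)
Let sg : R := strict%:R.

Definition in_region (u w : R) :=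
  delta <= u /\ (if strict then w < G u else w <= G u).

(* [oblique_height n v] is the largest [kappa] for which the exponent of the block
   [(n ^ 2, v, kappa)] is nonpositive on the closed region, up to the term [sg * n]. *)
Definition oblique_height (n v : nat) : R :=
  inf [set u * v%:R - G u * n%:R ^+ 2 | u in `[delta, 1]] + sg * n%:R.

(** The leading term of the resulting exponent is [(delta - u) * n ^ 4]; at [u = delta] there
    remains [(w - G delta) * n ^ 2 + sg * n]. *)
Definition wall_height (n : nat) : R :=
  delta * n%:R ^+ 4 - G delta * n%:R ^+ 2 + sg * n%:R.

Definition block_data := (nat * nat + nat)%type.

Definition block_leaves (d : block_data) : nat :=
  match d with inl (n, _) => n ^ 2 | inr n => n ^ 2 end.
Definition block_centers (d : block_data) : nat :=
  match d with inl (_, v) => v | inr n => n ^ 4 end.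
Definition block_height (d : block_data) : R :=
  match d with inl (n, v) => oblique_height n v | inr n => wall_height n end.

(** The binary logarithm of [K * N]^ (- u) * L [^ w] for a block whose [K], [N] and [L] are 2 to the
    power of its height, centers and leaves. *)
Definition block_exponent (u w : R) (d : block_data) : R :=
  w * (block_leaves d)%:R - u * (block_centers d)%:R + block_height d.

Let oblique_set n v := [set u * v%:R - G u * n%:R ^+ 2 | u in `[delta, 1]].

Let oblique_lb n v : has_lbound (oblique_set n v).
Proof.
exists (- n%:R ^+ 2) => _ [u /= + <-]; rewrite in_itv/= => du.
have /andP[_ Gu] := Gbnd du; have n0 : 0 <= n%:R ^+ 2 :> R by rewrite exprn_ge0.
have u0 : 0 <= u * v%:R by rewrite mulr_ge0//; case/andP: delta01 du; lra.
have : G u * n%:R ^+ 2 <= 1 * n%:R ^+ 2 by rewrite ler_wpM2r.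
lra.
Qed.

Lemma block_exponent_bounded u w : 0 <= w <= 1 -> u <= 1 -> in_region u w ->
  exists E, forall d, block_exponent u w d <= E.
Proof.
move=> /andP[w0 w1] u1 [du wG]; have du1 : delta <= u <= 1 by rewrite du.
have [E1 [E10 HE1]] : exists E1, 0 <= E1 /\
    forall n : nat, (w - G u) * n%:R ^+ 2 + sg * n%:R <= E1.
  rewrite /sg; case: strict wG => wG.
    have c0 : 0 < G u - w by rewrite subr_gt0.
    exists (G u - w)^-1; split; first by rewrite invr_ge0 ltW.
    by move=> n; have := sub_quadratic_le n c0; rewrite mul1r; lra.
  exists 0; split=> // n; have n0 : 0 <= n%:R ^+ 2 :> R by rewrite exprn_ge0.
  by rewrite mul0r addr0 mulr_le0_ge0// subr_le0.
have [E2 [E20 HE2]] : exists E2, 0 <= E2 /\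
    forall n : nat, block_exponent u w (inr n) <= E2.
  have [ud|ud] := eqVneq u delta.
    exists E1; split=> // n; apply: le_trans (HE1 n).
    by rewrite /block_exponent/= /wall_height ud !natrX; lra.
  have c0 : 0 < u - delta by rewrite subr_gt0 lt_neqAle eq_sym ud.
  (* With [c = u - delta] and [y = n ^ 2] the exponent is at most [3 * y - c * y ^ 2], which never
     exceeds [9 / c]. *)
  exists (9 / (u - delta)); split; first by rewrite divr_ge0// ltW.
  move=> n; rewrite /block_exponent/= /wall_height !natrX.
  have /andP[Gd _] : -1 <= G delta <= 1 by apply: Gbnd; case/andP: delta01 => _ ->; rewrite lexx.
  have sg1 : sg * n%:R <= n%:R ^+ 2 :> R.
    rewrite /sg -natrX -natrM ler_nat; case: strict; rewrite ?mul0n// mul1n.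
    by case: n => // n; rewrite expnS leq_pmulr// expn_gt0.
  set c := u - delta in c0 *; set y := n%:R ^+ 2 in sg1 *.
  have y0 : 0 <= y by rewrite exprn_ge0.
  have -> : n%:R ^+ 4 = y ^+ 2 :> R by rewrite /y -exprM.
  have wy : (w - G delta) * y <= 2 * y by rewrite ler_wpM2r//; lra.
  have -> : u = c + delta by rewrite /c; ring.
  have cc : c * (9 / c) = 9 by field; rewrite gt_eqF.
  rewrite -(ler_pM2l c0) cc.
  have := sqr_ge0 (c * y - 2); have H : w * y - G delta * y + sg * n%:R <= 3 * y by lra.
  have : c * (w * y - G delta * y + sg * n%:R) <= c * (3 * y) by rewrite ler_pM2l.
  nra.
exists (E1 + E2) => -[[n v]|n]; last by apply: le_trans (HE2 n) _; lra.
apply: (@le_trans _ _ E1); last by lra.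
apply: le_trans (HE1 n); rewrite /block_exponent/= /oblique_height natrX.
have : inf (oblique_set n v) <= u * v%:R - G u * n%:R ^+ 2.
  by apply: ge_inf => //; exists u => //=; rewrite in_itv.
rewrite /oblique_set; lra.
Qed.

Lemma in_region_of_bounded u w E : 0 <= w <= 1 -> 0 <= u <= 1 ->
  (forall d, block_exponent u w d <= E) -> in_region u w.
Proof.
move=> /andP[w0 w1] /andP[u0 u1] HE.
have nsq (n : nat) : n%:R <= n%:R ^+ 2 :> R.
  rewrite -natrX ler_nat; by case: n => // n; rewrite expnS leq_pmulr// expn_gt0.
have sg0 (n : nat) : 0 <= sg * n%:R :> R by rewrite /sg mulr_ge0.
(* an exponent at least [c * n ^ 2 - 1 + sg * n] is unbounded outside the region *)
have unb c : (if strict then 0 <= c else 0 < c) ->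
    ~ (forall n : nat, exists2 d, True & c * n%:R ^+ 2 - 1 + sg * n%:R <= block_exponent u w d).
  move=> hc H.
  have [n nE] : exists n : nat, E < c * n%:R ^+ 2 - 1 + sg * n%:R.
    move: hc; rewrite /sg; case: strict => c0.
      exists (Num.truncn (E + 1)).+1; have := truncnS_gt (E + 1).
      set n := (Num.truncn _).+1 => En.
      have : 0 <= c * n%:R ^+ 2 by rewrite mulr_ge0// exprn_ge0.
      rewrite mul1r; lra.
    exists (Num.truncn ((E + 1) / c)).+1; have := truncnS_gt ((E + 1) / c).
    set n := (Num.truncn _).+1; rewrite ltr_pdivrMr// => En.
    have : n%:R * c <= n%:R ^+ 2 * c by rewrite ler_wpM2r// ltW.
    rewrite mul0r; lra.
  have [d _] := H n; have := HE d; lra.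
have [Gd1 Gd2] : -1 <= G delta /\ G delta <= 1.
  by apply/andP; apply: Gbnd; case/andP: delta01 => _ ->; rewrite lexx.
(* For [u < delta] the term [(delta - u) * n ^ 4] of the wall blocks outgrows all the others. *)
have du : delta <= u.
  rewrite leNgt; apply/negP => ud; have c0 : 0 < delta - u by rewrite subr_gt0.
  have [n nE] : exists n : nat, 1 <= n%:R :> R /\ Num.max ((2 + `|E|) / (delta - u)) 1 <= n%:R :> R.
    exists (Num.truncn (Num.max ((2 + `|E|) / (delta - u)) 1)).+1.
    by split; [rewrite ler1n|rewrite ltW// truncnS_gt].
  case: nE => n1; rewrite ge_max ler_pdivrMr// => /andP[nE _].
  have := HE (inr n); rewrite /block_exponent/= /wall_height !natrX.
  set y := n%:R ^+ 2; have y1 : 1 <= y by apply: le_trans n1 (nsq n).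
  have ny : n%:R <= y by exact: nsq.
  have -> : n%:R ^+ 4 = y * y :> R by rewrite /y -expr2 -exprM.
  have : n%:R * (delta - u) <= y * (delta - u) by rewrite ler_wpM2r// ltW.
  have : 0 <= w * y by rewrite mulr_ge0//; lra.
  have : G delta * y <= 1 * y by rewrite ler_wpM2r//; lra.
  have := sg0 n; have := ler_norm E; have := normr_ge0 E.
  nra.
split=> //; apply: contrapT => out.
have out' : if strict then 0 <= w - G u else 0 < w - G u.
  by move: out; case: strict => /negP; rewrite -?leNgt -?ltNge ?subr_ge0 ?subr_gt0.
(* A supporting line need not exist at [delta], so there the wall blocks decide. *)
have [ud|ud] := eqVneq u delta.
  apply: (unb (w - G u)) => // n; exists (inr n) => //.
  by rewrite /block_exponent/= /wall_height ud !natrX; lra.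
have {}ud : delta < u by rewrite lt_neqAle eq_sym ud.
have [a a0 Ha] := supporting_slope Gconc Gmono ud u1.
apply: (unb (w - G u)) => // n.
have an0 : 0 <= a * n%:R ^+ 2 by rewrite mulr_ge0// exprn_ge0.
(* The slope of the block approximates that of the supporting line at [u]; rounding [a * n ^ 2] down
   changes the infimum by at most 1. *)
exists (inl (n, Num.truncn (a * n%:R ^+ 2))) => //.
have /andP[] := truncn_itv an0; set v := Num.truncn _ => lo up.
have : - (G u * n%:R ^+ 2) + u * (a * n%:R ^+ 2) - 1 <= inf (oblique_set n v).
  apply: lb_le_inf; first by exists (delta * v%:R - G delta * n%:R ^+ 2); exists delta => //=;
    rewrite in_itv/= lexx; case/andP: delta01.
  move=> _ [t /= + <-]; rewrite in_itv/= => dt.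
  have := Ha _ dt; have n2 : 0 <= n%:R ^+ 2 :> R by rewrite exprn_ge0.
  move=> /(ler_wpM2r n2) Gt.
  have [d0 t1] : 0 <= t /\ t <= 1 by case/andP: dt => ? ?; case/andP: delta01 => ? ?; split => //; lra.
  have : t * (a * n%:R ^+ 2 - v%:R) <= 1 * 1.
    by apply: ler_pM => //; rewrite -natr1 in up; lra.
  lra.
have : u * v%:R <= u * (a * n%:R ^+ 2) by rewrite ler_wpM2l.
rewrite /block_exponent/= /oblique_height natrX /oblique_set; lra.
Qed.

End region.

(** Two implications instead of an equivalence: sufficiency relies on the embedding of l^q into l^r
    and so asks for [recip r <= recip q]. *)
Lemma block_space_exists (R : realType) (p : R) (N L : nat -> nat) (K : nat -> R) :
  1 < p -> (forall i, (0 < N i)%N) -> (forall i, (0 < L i)%N) -> (forall i, 0 < K i) ->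
  exists X : metric_measure_space R, ~ doubling X /\
    forall q r : \bar R, (1 <= q)%E -> (1 <= r)%E ->
      let bounded := exists B, forall i,
        K i * (N i)%:R `^ (- recip q) * (L i)%:R `^ recip r <= B in
      ((best_const X p q r < +oo)%E -> bounded) /\
      (recip r <= recip q -> bounded -> (best_const X p q r < +oo)%E).
Proof.
move=> p1 N0 L0 K0; have [U spec] := block_layout_exists L p1 N0 K0.
exists (layout_space U); split.
  exact: layout_not_doubling (spec_centerP spec) (spec_inf_nonleaf spec)
    (spec_mass_ge1 spec).
move=> q r q1 r1 /=; split; first exact: best_const_bound.
by move=> rq [B]; exact: best_const_lty.
Qed.

(** * Realization of a region by a space *)

Section region_space.
Context (R : realType) (p delta : R) (G : R -> R) (strict : bool).
Hypothesis p1 : 1 < p.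
Hypothesis delta01 : 0 <= delta <= 1.
Hypothesis Gconc : three_point_concave G delta.
Hypothesis Gmono : nondecreasing_on G delta.
Hypothesis Gbnd : forall u, delta <= u <= 1 -> -1 <= G u <= 1.
Hypothesis Gid : forall u, delta <= u <= 1 -> G u <= u.

Lemma region_space_exists : exists X : metric_measure_space R, ~ doubling X /\
  forall q r : \bar R, (1 <= q)%E -> (1 <= r)%E ->
    ((best_const X p q r < +oo)%E <->
     in_region delta G strict (recip q) (recip r)).
Proof.
(* The countably many blocks are enumerated by their codes; an index that codes nothing repeats the
   block [inr 0] and imposes no new condition. *)
pose data (i : nat) : block_data := odflt (inr 0%N) (unpickle i).
pose N i := (2 ^ block_centers (data i))%N.
pose L i := (2 ^ block_leaves (data i))%N.
pose K i := 2 `^ block_height delta G strict (data i).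
have N0 i : (0 < N i)%N by rewrite expn_gt0.
have L0 i : (0 < L i)%N by rewrite expn_gt0.
have K0 i : 0 < K i by rewrite powR_gt0.
have expE u w i : K i * (N i)%:R `^ (- u) * (L i)%:R `^ w =
    2 `^ block_exponent delta G strict u w (data i).
  rewrite /K /N /L !natrX -!powR_mulrn// -!powRrM.
  have pD x y : 2 `^ x * 2 `^ y = 2 `^ (x + y) :> R.
    by rewrite powRD// pnatr_eq0 implybT.
  by rewrite !pD /block_exponent; congr (_ `^ _); ring.
have [X [nd HX]] := block_space_exists p1 N0 L0 K0; exists X; split => // q r q1 r1.
have [HX1 HX2] := HX q r q1 r1.
have u01 := recip_bounds q1; have w01 := recip_bounds r1.
split=> [/HX1[B HB]|reg].
  apply: (in_region_of_bounded delta01 Gconc Gmono Gbnd w01 u01 (E := B)) => d.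
  apply: le_trans (powR2_ge _) _; have := HB (pickle d).
  by rewrite expE /data pickleK.
have u1 : recip q <= 1 by case/andP: u01.
apply: HX2.
  (* The assumption [G u <= u] supplies [recip r <= recip q] throughout the region. *)
  have [du wG] := reg; apply: le_trans (Gid _); last by rewrite du.
  by move: wG; case: strict => // /ltW.
have [E HE] := block_exponent_bounded delta01 Gbnd w01 u1 reg.
exists (2 `^ E) => i; rewrite expE; apply: ler_powR; first by rewrite ler1n.
exact: HE.
Qed.

End region_space.

(** * Concavity on the interval and the half-open case *)

Lemma concave_function_three_point (R : realType) (D : set R) (F : R -> R) x y z :
  concave_function D F -> D x -> D z -> x < y -> y < z ->
  (F z - F y) * (y - x) <= (F y - F x) * (z - y).
Proof.
move=> cF Dx Dz xy yz.
have zx : 0 < z - x by lra.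
have t0 : 0 <= (z - y) / (z - x) by rewrite divr_ge0; lra.
have t1 : (z - y) / (z - x) <= 1 by rewrite ler_pdivrMr; lra.
set t := (z - y) / (z - x) in t0 t1 *.
have H : - F (t * x + (1 - t) * z) <= t * - F x + (1 - t) * - F z.
  exact: (cF (Itv01 t0 t1) x z (mem_set Dx) (mem_set Dz)).
have yE : t * x + (1 - t) * z = y by rewrite /t; field; rewrite gt_eqF.
have tE : t * (z - x) = z - y by rewrite /t; field; rewrite gt_eqF.
rewrite yE in H.
have : (- F y) * (z - x) <= (t * - F x + (1 - t) * - F z) * (z - x).
  by rewrite ler_pM2r.
have -> : (t * - F x + (1 - t) * - F z) * (z - x) =
  - (F x * (t * (z - x))) - F z * ((z - x) - t * (z - x)) by ring.
rewrite tE; lra.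
Qed.

Theorem theorem2 : forall (R : realType) (p : R), 1 < p ->
  (forall (delta : R) (F : R -> R), 0 <= delta <= 1 ->
    admissible `[delta, 1] F ->
    (exists Y : metric_measure_space R, ~ doubling Y /\
       forall q r : \bar R, (1 <= q)%E -> (1 <= r)%E ->
         ((best_const Y p q r < +oo)%E <->
          delta <= recip q /\ recip r <= F (recip q))) /\
    (exists Z : metric_measure_space R, ~ doubling Z /\
       forall q r : \bar R, (1 <= q)%E -> (1 <= r)%E ->
         ((best_const Z p q r < +oo)%E <->
          delta <= recip q /\ recip r < F (recip q)))) /\
  (forall (delta : R) (F : R -> R), 0 <= delta < 1 ->
    admissible `]delta, 1] F ->
    (exists Y : metric_measure_space R, ~ doubling Y /\
       forall q r : \bar R, (1 <= q)%E -> (1 <= r)%E ->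
         ((best_const Y p q r < +oo)%E <->
          delta < recip q /\ recip r <= F (recip q))) /\
    (exists Z : metric_measure_space R, ~ doubling Z /\
       forall q r : \bar R, (1 <= q)%E -> (1 <= r)%E ->
         ((best_const Z p q r < +oo)%E <->
          delta < recip q /\ recip r < F (recip q)))).
Proof.
move=> R p p1; split=> delta F.
  move=> d01 [cF mF bF idF].
  have inD u : delta <= u <= 1 -> u \in `[delta, 1]%classic.
    by move=> du; rewrite inE/= in_itv.
  have conc : three_point_concave F delta.
    move=> x y z dx xy yz z1; apply: (concave_function_three_point cF) => //=;
      rewrite in_itv/=; apply/andP; split; lra.
  have mono : nondecreasing_on F delta.
    move=> x y dx xy y1; apply: mF => //; apply: inD; apply/andP; split; lra.
  have bnd u : delta <= u <= 1 -> -1 <= F u <= 1.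
    by move=> /inD/bF/andP[? ?]; apply/andP; split=> //; lra.
  have idF' u : delta <= u <= 1 -> F u <= u by move=> /inD/idF.
  by split; [exact: (region_space_exists false p1 d01 conc mono bnd idF')|
             exact: (region_space_exists true p1 d01 conc mono bnd idF')].
move=> /andP[d0 d1] [cF mF bF idF].
have d01 : 0 <= delta <= 1 by rewrite d0 ltW.
have inD u : delta < u -> u <= 1 -> u \in `]delta, 1]%classic.
  by move=> du u1; rewrite inE/= in_itv/= du u1.
(* [G delta = -1] puts the points [(delta, w)] with [w >= 0] outside the region *)
pose G u : R := if u == delta then -1 else F u.
have Gd : G delta = -1 by rewrite /G eqxx.
have GF u : delta < u -> G u = F u by move=> du; rewrite /G gt_eqF.
have F01 u : delta < u -> u <= 1 -> 0 <= F u /\ F u <= 1.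
  by move=> du u1; apply/andP; apply: bF; exact: inD.
have concF x y z : delta < x -> x < y -> y < z -> z <= 1 ->
    (F z - F y) * (y - x) <= (F y - F x) * (z - y).
  move=> dx xy yz z1; apply: (concave_function_three_point cF) => //=;
    rewrite in_itv/=; apply/andP; split; lra.
have conc : three_point_concave G delta.
  move=> x y z dx xy yz z1.
  rewrite (GF y) ?(GF z); [|lra..].
  have [xd|xd] := eqVneq x delta; last first.
    by rewrite GF ?concF// lt_neqAle eq_sym xd.
  rewrite xd Gd.
  (* a point [x'] of [(delta, y)] closer to [delta] than [z - y] *)
  pose x' := delta + Num.min (z - y) ((y - delta) / 2).
  have m1 : Num.min (z - y) ((y - delta) / 2) <= z - y by rewrite ge_min lexx.
  have m2 : Num.min (z - y) ((y - delta) / 2) <= (y - delta) / 2.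
    by rewrite ge_min lexx orbT.
  have m0 : 0 < Num.min (z - y) ((y - delta) / 2).
    by rewrite lt_min; apply/andP; split; lra.
  have h1 : delta < x' by rewrite /x'; lra.
  have h2 : x' < y by rewrite /x'; lra.
  have h3 : x' - delta <= z - y by rewrite /x'; lra.
  have C := concF x' y z h1 h2 yz z1.
  have [Fx0 _] := F01 x' h1 (ltW (lt_le_trans h2 (ltW (lt_le_trans yz z1)))).
  have [Fy0 Fy1] : 0 <= F y /\ F y <= 1 by apply: F01; lra.
  have [Fz0 Fz1] : 0 <= F z /\ F z <= 1 by apply: F01; lra.
  have : F x' * (z - y) >= 0 by rewrite mulr_ge0// subr_ge0 ltW.
  (* Replacing [delta] by [x'] costs at most [x' - delta <= z - y], which the jump from -1 at
     [delta] compensates. *)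
  have : (F z - F y) * (x' - delta) <= 1 * (x' - delta).
    by rewrite ler_wpM2r; lra.
  lra.
have mono : nondecreasing_on G delta.
  move=> x y dx xy y1; have [yd|yd] := eqVneq y delta.
    by have -> : x = y by apply/eqP; rewrite eq_le xy/= yd.
  have dy : delta < y by rewrite lt_neqAle eq_sym yd (le_trans dx xy).
  have [Fy0 _] := F01 y dy y1.
  rewrite (GF y)//; have [->|xd] := eqVneq x delta; first by rewrite Gd; lra.
  have dx' : delta < x by rewrite lt_neqAle eq_sym xd.
  by rewrite GF//; apply: mF => //; apply: inD => //; exact: le_trans xy y1.
have bnd u : delta <= u <= 1 -> -1 <= G u <= 1.
  move=> /andP[du u1]; have [->|ud] := eqVneq u delta.
    by rewrite Gd lexx/=; lra.
  have du' : delta < u by rewrite lt_neqAle eq_sym ud.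
  by have [? ?] := F01 u du' u1; rewrite GF//; apply/andP; split; lra.
have idG u : delta <= u <= 1 -> G u <= u.
  move=> /andP[du u1]; have [->|ud] := eqVneq u delta; first by rewrite Gd; lra.
  have du' : delta < u by rewrite lt_neqAle eq_sym ud.
  by rewrite GF//; apply: idF; exact: inD.
have regE strict u w : 0 <= w -> in_region delta G strict u w <->
    delta < u /\ (if strict then w < F u else w <= F u).
  move=> w0; rewrite /in_region; split=> [[du wG]|[du wF]]; last first.
    by rewrite GF// ltW.
  have [ud|ud] := eqVneq u delta.
    by move: wG; rewrite ud Gd; case: strict => h; exfalso; lra.
  have du' : delta < u by rewrite lt_neqAle eq_sym ud.
  by rewrite -GF.
split.
  have [X [nd HX]] := region_space_exists false p1 d01 conc mono bnd idG.
  exists X; split=> // q r q1 r1; case/andP: (recip_bounds r1) => w0 _.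
  exact: iff_trans (HX q r q1 r1) (regE false (recip q) _ w0).
have [X [nd HX]] := region_space_exists true p1 d01 conc mono bnd idG.
exists X; split=> // q r q1 r1; case/andP: (recip_bounds r1) => w0 _.
exact: iff_trans (HX q r q1 r1) (regE true (recip q) _ w0).
Qed.
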